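(* Let $(I^{\rm ex}_i)_{1\le i\le n}$ be an exchangeable interval partition of $[0,1]$ into $n$ subintervals of strictly positive length. Let $(I^D_j)_{1\le j\le J^D_n}$ and $(I^T_j)_{1\le j\le J^T_n}$ be the $D$- and $T$-partitions of $[0,1]$ derived from it. For $I_j$ an interval of either of these partitions, let $N_{I_j}$ be the number of intervals of $(I^{\rm ex}_i)_{1\le i\le n}$ which are contained in $I_j$, so $1\le N_{I_j}\le n$. Consider the four bivariate sequences $(\lambda_{I_j},N_{I_j})_j$ for $(I_j)$ equal to $(I^D_j)$, its length-ranking $(I^D_{(j)})$, $(I^T_j)$, or its length-ranking $(I^T_{(j)})$. Then: (i) the bivariate sequence has the same distribution for $(I^D_{(j)})$ as for $(I^T_{(j)})$; (ii) the bivariate sequence for $(I^D_j)$ is the bivariate sequence for $(I^D_{(j)})$ in a length-biased order; (iii) the bivariate sequence for $(I^T_j)$ is the bivariate sequence for $(I^T_{(j)})$ in an $N$-biased order; (iv) the sequence $(N_{I_j})$ has the same distribution for $(I_j)=(I^D_j)$ as for $(I_j)=(I^T_j)$, whereas the sequence of lengths $(\lambda_{I_j})$ does not.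
   Context: $\lambda_I$ denotes the length of an interval $I$. An exchangeable interval partition of $[0,1]$ into $n$ subintervals of strictly positive length is a random partition of $[0,1]$ (up to endpoints) into $n$ intervals, with lengths almost surely all distinct, such that for each $m=2,3,\ldots$ with $m\le n$ the ordering in $[0,1]$ of the $m$ longest intervals is equally likely to be any one of the $m!$ possible orders, independently of the lengths of these $m$ intervals. Let $\mathcal U=\{u_j\}_{0\le j\le n}$, with $0=u_0<u_1<\cdots<u_n=1$, be the random set of endpoints of the intervals $(I^{\rm ex}_i)_{1\le i\le n}$. $D$-partition: let $U_1,U_2,\ldots$ be independent uniform$(0,1)$ variables, independent of $(I^{\rm ex}_i)$. Put $V_0=D_{V_0}=0$ and, inductively while $D_{V_{j-1}}<1$, $V_j=D_{V_{j-1}}+U_j(1-D_{V_{j-1}})$ and $D_{V_j}=\inf\{t\ge V_j:t\in\mathcal U\}$. Let $J^D_n$ be the first $j$ such that $D_{V_j}=1$, and $I^D_j=[D_{V_{j-1}},D_{V_j}]$ for $1\le j\le J^D_n$. $T$-partition: $T_0=0$; given the random set of endpoints $\mathcal U$, let $T_1$ have uniform distribution on $\mathcal U\cap(0,1]$; given also $T_1=t_1<1$, let $T_2$ have uniform distribution on $\mathcal U\cap(t_1,1]$; and so on, until $T_{J^T_n}=1$. Put $I^T_j=[T_{j-1},T_j]$ for $1\le j\le J^T_n$. Length-ranking: $I^D_{(j)}$ is the $j$th longest interval of the $D$-partition, and $I^T_{(j)}$ is the $j$th longest interval of the $T$-partition. Biased order: for an interval partition $(I_j)$ with length-ranking $(I_{(j)})$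 and weights $w_I>0$, with $\Sigma=\sum_j w_{I_j}$, the bivariate sequence for $(I_j)$ is that for $(I_{(j)})$ in $w$-biased order if, conditionally given $(\lambda_{I_{(j)}},N_{I_{(j)}})_j$, one has $I_1=I_{(k)}$ with probability $w_{I_{(k)}}/\Sigma$ for each $k$; given also $I_1$, one has $I_2=I_{(k)}$ with probability $w_{I_{(k)}}/(\Sigma-w_{I_1})$ for each remaining $k$; and so on. Length-biased means $w_I=\lambda_I$; $N$-biased means $w_I=N_I$.
   Formalization: In (iv), the claim that the sequences of lengths do not have the same distribution is stated and proved for every n ≥ 2 only; for n = 1 both partitions are {[0,1]}, so the length sequences coincide and that clause fails. *)

(* Defs.v *)
From HB Require Import structures.
From mathcomp Require Export all_boot all_order all_algebra all_fingroup.
From mathcomp Require Export all_classical all_reals all_analysis.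
Set Implicit Arguments.
Unset Strict Implicit.
Unset Printing Implicit Defensive.
Import Order.TTheory GRing.Theory Num.Theory.
Import numFieldNormedType.Exports.
Local Open Scope classical_set_scope.
Local Open Scope ring_scope.

(* Finite sequences of random length are compared through the sigma-algebra of
   the disjoint union of the powers T^m, m >= 0. *)
Definition seq_measurable d (T : measurableType d) (A : set (seq T)) : Prop :=
  forall m : nat, measurable [set t : m.-tuple T | A (tval t)].

Definition same_law d (Omega : measurableType d) (R : realType)
    (P : probability Omega R) d' (T : measurableType d')
    (X Y : Omega -> seq T) : Prop :=
  forall A : set (seq T), seq_measurable A -> P (X @^-1` A) = P (Y @^-1` A).

(* Probability that successive draws without replacement from y, each drawn
   item being chosen among the remaining ones with probability proportional to
   its weight, pick the positions s 0, s 1, ... in this order. *)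
Definition biased_perm_prob (R : realType) (T : Type) (wt : T -> R)
    (y : seq T) (s : 'S_(size y)) : R :=
  let W (j : 'I_(size y)) := wt (tnth (in_tuple y) (s j)) in
  \prod_(j < size y)
    (W j / (\sum_(x <- y) wt x - \sum_(i < size y | (i < j)%N) W i)).

Definition reorder (T : Type) (y : seq T) (s : 'S_(size y)) : seq T :=
  [seq tnth (in_tuple y) (s j) | j <- enum 'I_(size y)].

Definition biased_kernel (R : realType) (T : Type) (wt : T -> R)
    (y : seq T) (B : set (seq T)) : R :=
  \sum_(s : 'S_(size y)) biased_perm_prob wt s * \1_B (reorder s).

(* X is Y in wt-biased order: the conditional law of X given Y is
   biased_kernel wt Y. *)
Definition is_biased_order d (Omega : measurableType d) (R : realType)
    (P : probability Omega R) d' (T : measurableType d') (wt : T -> R)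
    (X Y : Omega -> seq T) : Prop :=
  forall A B : set (seq T), seq_measurable A -> seq_measurable B ->
    P (Y @^-1` A `&` X @^-1` B) =
    (\int[P]_(w in Y @^-1` A) (biased_kernel wt (Y w) B)%:E)%E.

Section interval_partitions.
Context d (Omega : measurableType d) (R : realType) (P : probability Omega R).
Context (n : nat).

(* u i is the i-th endpoint; the i-th interval is [u_i, u_{i+1}], i < n. *)
Variable u : 'I_n.+1 -> {RV P >-> R}.

Definition left_end (i : 'I_n) (w : Omega) : R := u (widen_ord (leqnSn n) i) w.
Definition right_end (i : 'I_n) (w : Omega) : R := u (lift ord0 i) w.
Definition len (i : 'I_n) (w : Omega) : R := right_end i w - left_end i w.

(* The longest interval has rank 0. *)
Definition len_rank (i : 'I_n) (w : Omega) : nat :=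
  #|[set j : 'I_n | len i w < len j w]%SET|.

(* The ranks of the m longest intervals, read from left to right in [0, 1]. *)
Definition longest_order (m : nat) (w : Omega) : seq nat :=
  [seq r <- [seq len_rank i w | i <- enum 'I_n] | (r < m)%N].

Definition longest_lengths (m : nat) (w : Omega) : seq R :=
  take m (sort >=%O [seq len i w | i <- enum 'I_n]).

Definition perm_word (m : nat) (s : 'S_m) : seq nat :=
  [seq nat_of_ord (s i) | i <- enum 'I_m].

Definition exchangeable_partition : Prop :=
  [/\ forall w, u ord0 w = 0 /\ u ord_max w = 1,
      forall w (i j : 'I_n.+1), (i < j)%N -> u i w < u j w,
      {ae P, forall w, injective (fun i : 'I_n => len i w)} &
      forall m : nat, (2 <= m <= n)%N -> forall s : 'S_m,
        let ordered_as_s := [set w | longest_order m w = perm_word s] in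
        P ordered_as_s = ((m`!)%:R^-1)%:E /\
        forall A : set (seq R), seq_measurable A ->
          P (ordered_as_s `&` longest_lengths m @^-1` A) =
          (P ordered_as_s * P (longest_lengths m @^-1` A))%E].

Definition endpoints (w : Omega) : set R := range (fun i => u i w).

(* U j stands for the (j+1)-st uniform variable.  Mutual independence is the
   product rule over finite subfamilies; independence from the partition is
   the product rule for events determined by all the endpoints. *)
Definition uniform_inputs (U : nat -> {RV P >-> R}) : Prop :=
  [/\ forall j (B : set R), measurable B ->
        distribution P (U j) B = uniform_prob (@ltr01 R) B,
      forall (J : seq nat) (B : nat -> set R), uniq J ->
        (forall j, measurable (B j)) ->
        P (\big[setI/setT]_(j <- J) (U j @^-1` B j)) =
        (\prod_(j <- J) P (U j @^-1` B j))%E &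
      forall (A : set (n.+1.-tuple R)) (J : seq nat) (B : nat -> set R),
        measurable A -> uniq J -> (forall j, measurable (B j)) ->
        let in_A := [set w | A [tuple u i w | i < n.+1]] in
        let in_B := \big[setI/setT]_(j <- J) (U j @^-1` B j) in
        P (in_A `&` in_B) = (P in_A * P in_B)%E].

(* D_{V_j}.  Once the value 1 is reached the recursion stays there. *)
Fixpoint DV (U : nat -> {RV P >-> R}) (j : nat) (w : Omega) : R :=
  if j is j'.+1 then
    let V := DV U j' w + U j' w * (1 - DV U j' w) in
    inf [set t | V <= t /\ endpoints w t]
  else 0.

(* The uniform distribution on (endpoints w) `&` ]t, 1]: the endpoints u i w
   are pairwise distinct and at most 1, so points are counted by index. *)
Definition uniform_above (w : Omega) (t : R) (B : set R) : R :=
  #|[set i : 'I_n.+1 | (t < u i w) && (u i w \in B)]%SET|%:R /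
  #|[set i : 'I_n.+1 | t < u i w]%SET|%:R.

(* Given all the endpoints and T_0, ..., T_j, on the event that 1 has not been
   reached yet, T_{j+1} is uniform on the endpoints in ]T_j, 1].  The values of
   T after 1 is reached are irrelevant and left unconstrained. *)
Definition T_chain (T : nat -> {RV P >-> R}) : Prop :=
  (forall w, T 0%N w = 0) /\
  forall (j : nat) (C : set (n.+1.-tuple R * j.+1.-tuple R)) (B : set R),
    measurable C -> measurable B ->
    let E := [set w | C ([tuple u i w | i < n.+1], [tuple T i w | i < j.+1]) /\
                      forall i, (i <= j)%N -> T i w < 1] in
    P (E `&` T j.+1 @^-1` B) =
    (\int[P]_(w in E) (uniform_above w (T j w) B)%:E)%E.

(* The first j such that x j = 1 (junk value 0 if there is none). *)
Definition first_hit1 (x : nat -> R) : nat :=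
  xget 0%N [set j | x j = 1 /\ forall i, (i < j)%N -> x i <> 1].

Definition num_inside (a b : R) (w : Omega) : nat :=
  #|[set i : 'I_n | (a <= left_end i w) && (right_end i w <= b)]%SET|.

(* The bivariate sequence (length, number of intervals contained) of the
   partition with successive endpoints X 0, X 1, ..., until 1 is reached. *)
Definition bivariate (X : nat -> Omega -> R) (w : Omega) : seq (R * nat) :=
  [seq (X j.+1 w - X j w, num_inside (X j w) (X j.+1 w) w)
     | j <- iota 0 (first_hit1 (fun j => X j w))].

End interval_partitions.

(* Decreasing length.  Although the n lengths are distinct, intervals of the
   D- or T-partition may have equal lengths; such ties are broken by decreasing
   number of intervals contained, hence by a function of the unordered family
   of pairs alone. *)
Definition longer (R : realType) (p q : R * nat) : bool :=
  (q.1 < p.1) || ((q.1 == p.1) && (q.2 <= p.2)%N).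

Definition ranked (R : realType) (Omega : Type) (X : Omega -> seq (R * nat))
    (w : Omega) : seq (R * nat) :=
  sort (@longer R) (X w).

Definition lengths (R : realType) (Omega : Type) (X : Omega -> seq (R * nat))
    (w : Omega) : seq R := [seq p.1 | p <- X w].

Definition counts (R : realType) (Omega : Type) (X : Omega -> seq (R * nat))
    (w : Omega) : seq nat := [seq p.2 | p <- X w].

(* Main.v *)
Require Import Defs.
From mathcomp Require Import measurable_realfun ring lra zify.
Set Implicit Arguments.
Unset Strict Implicit.
Unset Printing Implicit Defensive.
Import Order.TTheory GRing.Theory Num.Theory.
Import numFieldNormedType.Exports.
Local Open Scope classical_set_scope.
Local Open Scope ring_scope.

(** Let [l_1, ..., l_n] be the lengths of the intervals from left to right and
    [u_0, ..., u_n] the endpoints. Given the endpoints, both partitions follow a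
    Markov chain through them: from [u_i], the D-chain moves to [u_k] with
    probability [l_k / (l_(i+1) + ... + l_n)] and the T-chain with probability
    [1 / (n - i)]. So the probability that the successive blocks are
    [B_1, ..., B_m], with masses [L_j] and sizes [N_j], is the product over [j] of
    [l_(last of B_j) / (L_j + ... + L_m)], respectively of
    [1 / (N_j + ... + N_m)] ([path_law], [DV_law_step], [T_law_step],
    [path_prob_D], [path_prob_T]).

    By exchangeability the sequence of the lengths is a uniform permutation of
    the decreasing sequence of lengths ([exchangeable_integral]). The law of
    either bivariate sequence is therefore a sum over all the arrangements of the
    [n] lengths cut into blocks ([bivariate_integral]). Rotating a block changes
    neither [L_j] nor [N_j], so that in this sum [l_(last of B_j)] can be replaced
    by the mean [L_j / N_j] ([average_last_mass]). Both laws then have the same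
    form, a product of the [1 / N_j] and of the [w_j / (w_j + ... + w_m)], with
    [w_j = L_j] for D and [w_j = N_j] for T ([sum_pathD], [sum_pathT]). The first
    product is symmetric in the blocks, and the second one is the probability
    that drawing the blocks in [w]-biased order gives the order [1, ..., m].
    Since the set of all cut arrangements is stable under permutations of the
    blocks, the first product alone gives the law of the length-ranking, which is
    thus the same for D and T ([ranked_law]), and given the length-ranking the
    blocks come in [w]-biased order ([biased_sum_mean], [ranked_biased_order]).

    For the counts, the weight of D averaged over all the orders of the lengths is
    the product of the [1 / (N_j + ... + N_m)], hence equal to the weight of T
    ([sum_pathD_shape], [counts_law]). The laws of the lengths differ because the
    first T-interval has mean [(1 + 1/n) / 2], and the first D-interval the mean
    of [(1 + l_1^2 + ... + l_n^2) / 2], which is larger as soon as the lengths are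
    not all equal ([lengths_not_same_law]).

    The hypotheses on the uniform variables and on the T-chain are product rules
    on rectangles. They are extended to the events that compare the next point of
    the chain with the random endpoints by [pair_law_mixture] and
    [pair_law_indep], and from events to integrals by [eq_integral_given]. *)

(** * Sums over the arrangements of a list *)

Section SumPermutations.
Context (V : nmodType) (T : eqType).
Implicit Types (L s : seq T) (F : T -> V).

(** An injection of a list into itself permutes it, so that a sum can be
    reindexed along it. *)
Lemma reindex_inj_in (P : pred T) L (f : T -> T) F : uniq L ->
  {in L & L, injective f} ->
  {in L, forall x, P x -> P (f x) /\ f x \in L} ->
  \sum_(x <- L | P x) F x = \sum_(x <- L | P x) F (f x).
Proof.
move=> uL injf fL; rewrite -big_filter -[RHS]big_filter -[RHS](big_map f xpredT).
apply: perm_big; rewrite perm_sym.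
have uf : uniq [seq f x | x <- L & P x].
  rewrite map_inj_in_uniq ?filter_uniq// => x y.
  by rewrite !mem_filter => /andP[_ xL] /andP[_ yL]; exact: injf.
apply: uniq_perm; [by []|exact: filter_uniq|].
have sub : {subset [seq f x | x <- L & P x] <= [seq x <- L | P x]}.
  move=> _ /mapP[x + ->]; rewrite !mem_filter => /andP[Px xL].
  by have [-> ->] := fL _ xL Px.
by have [] := uniq_min_size uf sub _; rewrite ?size_map.
Qed.

Lemma big_permutations_rem L (F : seq T -> V) : uniq L -> (0 < size L)%N ->
  \sum_(s <- permutations L) F s =
  \sum_(x <- L) \sum_(s <- permutations (rem x L)) F (x :: s).
Proof.
move=> uL L0; rewrite (perm_big _ (permutationsE L0)) undup_id//.
by rewrite big_allpairs_dep.
Qed.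

Lemma map_nth_injective (x0 : T) (t : seq nat) (m : nat) (L : seq (seq T)) :
  perm_eq t (iota 0 m) -> {in L, forall z, size z = m} ->
  {in L & L, injective (fun z => [seq nth x0 z i | i <- t])}.
Proof.
move=> tm szL z z' zL z'L /eq_in_map zz'.
apply: (@eq_from_nth _ x0) => [|i iz]; first by rewrite !szL.
by apply: zz'; rewrite (perm_mem tm) mem_iota /= add0n -(szL _ zL).
Qed.

Lemma perm_map_nth (x0 : T) (t : seq nat) (z : seq T) :
  perm_eq t (iota 0 (size z)) -> perm_eq [seq nth x0 z i | i <- t] z.
Proof. by move=> tz; apply/(perm_iotaP x0); exists t. Qed.

End SumPermutations.

(** The sum over the orders in which the positions of a list can be read is a
    symmetric function of this list, repeated items included. *)
Lemma big_orders_perm (V : nmodType) (T : eqType) (x0 : T) (z z' : seq T)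
    (F : seq T -> V) :
  perm_eq z' z ->
  \sum_(t <- permutations (iota 0 (size z'))) F [seq nth x0 z' i | i <- t] =
  \sum_(t <- permutations (iota 0 (size z))) F [seq nth x0 z i | i <- t].
Proof.
move=> zz'; have [r rz ->] := perm_iotaP x0 zz'.
have sr : size r = size z by rewrite (perm_size rz) size_iota.
rewrite size_map sr.
transitivity (\sum_(t <- permutations (iota 0 (size z)))
    F [seq nth x0 z i | i <- [seq nth 0%N r j | j <- t]]).
  rewrite [LHS]big_seq [RHS]big_seq; apply: eq_bigr => t.
  rewrite mem_permutations => tz; congr F; rewrite -map_comp.
  apply/eq_in_map => i; rewrite (perm_mem tz) mem_iota /= add0n => iz.
  by rewrite (nth_map 0%N)// sr.
apply/esym/(@reindex_inj_in _ _ xpredT) => [||t].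
- exact: permutations_uniq.
- move=> t t'; rewrite !mem_permutations => tz t'z /= tt'.
  have lt s i : perm_eq s (iota 0 (size z)) -> i \in s -> (i < size r)%N.
    by move=> /perm_mem -> ; rewrite mem_iota add0n sr.
  have ur : uniq r by rewrite (perm_uniq rz) iota_uniq.
  apply: (@eq_from_nth _ 0%N) => [|i it].
    by rewrite (perm_size tz) (perm_size t'z).
  have it' : (i < size t')%N by rewrite (perm_size t'z) -(perm_size tz).
  have := congr1 (fun s => nth 0%N s i) tt'; rewrite !(nth_map 0%N)// => /eqP.
  rewrite nth_uniq//; last 2 first.
  - exact: (lt t _ tz (mem_nth _ _)).
  - exact: (lt t' _ t'z (mem_nth _ _)).
  by move/eqP.
- rewrite !mem_permutations => tz _; split=> //.
  rewrite -sr in tz; exact: perm_trans (perm_map_nth _ tz) rz.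
Qed.

(** * Biased orders *)

Section BiasedWeight.
Context (R : realFieldType).
Implicit Types (z : seq R).

(** The product of the reciprocals of all tail sums of [z]. *)
Fixpoint inv_tails z : R :=
  if z is x :: z' then (\sum_(t <- z) t)^-1 * inv_tails z' else 1.

(** The probability that successive draws without replacement, biased by the
    items of [z] themselves, produce exactly the order of [z]. *)
Definition biased_weight z : R := (\prod_(x <- z) x) * inv_tails z.

Lemma inv_tails_ge0 z : {in z, forall x, 0 <= x} -> 0 <= inv_tails z.
Proof.
elim: z => [|x z IH] /= z0; first exact: ler01.
rewrite mulr_ge0 ?invr_ge0//; last first.
  by apply: IH => t tz; apply: z0; rewrite inE tz orbT.
by rewrite big_seq sumr_ge0.
Qed.

Lemma biased_weight_ge0 z : {in z, forall x, 0 <= x} -> 0 <= biased_weight z.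
Proof.
by move=> z0; rewrite mulr_ge0 ?inv_tails_ge0// big_seq prodr_ge0.
Qed.

Lemma biased_weight_cons x z :
  biased_weight (x :: z) = x / (\sum_(t <- x :: z) t) * biased_weight z.
Proof. by rewrite /biased_weight big_cons /= mulrACA. Qed.

(** The weight as the product that defines successive biased draws: [S] minus
    the items already drawn is the sum of the remaining ones. *)
Lemma biased_weight_ord m (f : 'I_m -> R) (S : R) : S = \sum_i f i ->
  \prod_(j < m) (f j / (S - \sum_(i < m | (i < j)%N) f i)) =
  biased_weight [seq f j | j <- enum 'I_m].
Proof.
elim: m f S => [|m IH] f S SE.
  by rewrite big_ord0 enum_ord0 /biased_weight big_nil mul1r.
rewrite big_ord_recl big_pred0 // subr0 enum_ordSl /= biased_weight_cons.
rewrite big_cons big_map big_map big_enum/= {1}SE big_ord_recl; congr (_ * _).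
rewrite -map_comp -(IH (f \o lift ord0) (S - f ord0)); last first.
  by rewrite SE big_ord_recl addrC addKr.
apply: eq_bigr => j _; congr (_ / _).
by rewrite big_mkcond big_ord_recl/= opprD addrA -big_mkcond.
Qed.

Lemma biased_weight_sum1 (T : eqType) (wt : T -> R) (L : seq T) :
  uniq L -> {in L, forall x, 0 < wt x} ->
  \sum_(s <- permutations L) biased_weight [seq wt x | x <- s] = 1.
Proof.
elim: {L}(size L) {-2}L (erefl (size L)) => [|m IH] L.
  by move=> /size0nil -> _ _; rewrite big_seq1 /biased_weight big_nil mul1r.
move=> sL uL wL; rewrite big_permutations_rem ?sL//.
transitivity (\sum_(x <- L) wt x / (\sum_(t <- L) wt t)).
  rewrite big_seq [RHS]big_seq; apply: eq_bigr => x xL.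
  transitivity (\sum_(s <- permutations (rem x L))
      wt x / (\sum_(t <- L) wt t) * biased_weight [seq wt x | x <- s]).
    rewrite big_seq [RHS]big_seq; apply: eq_bigr => s.
    rewrite mem_permutations => sx /=; rewrite biased_weight_cons.
    rewrite -map_cons big_map (perm_big L)//
      (perm_trans _ (_ : perm_eq (x :: rem x L) L)) //.
      by rewrite perm_cons.
    by rewrite perm_sym perm_to_rem.
  rewrite -mulr_sumr IH ?mulr1 ?rem_uniq//.
    by rewrite size_rem// sL.
  by move=> t /mem_rem; exact: wL.
rewrite -mulr_suml divff// gt_eqF//.
case: L sL wL {uL} => // a L _ wL; rewrite big_cons ltr_pwDl ?wL ?mem_head//.
by rewrite big_seq sumr_ge0// => i iL; rewrite ltW// wL// inE iL orbT.
Qed.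

End BiasedWeight.

Section BiasedMean.
Context (R : realFieldType) (T : eqType) (x0 : T) (wt : T -> R).
Implicit Types (z : seq T) (Psi : seq T -> R).

(** The expectation of [Psi] at the list [z] put in [wt]-biased order. *)
Definition biased_mean Psi z : R :=
  \sum_(t <- permutations (iota 0 (size z)))
    biased_weight [seq wt x | x <- [seq nth x0 z i | i <- t]] *
    Psi [seq nth x0 z i | i <- t].

(** The biased order forgets the initial order of the list. *)
Lemma biased_mean_perm Psi z z' :
  perm_eq z' z -> biased_mean Psi z' = biased_mean Psi z.
Proof.
move=> zz'.
exact: (big_orders_perm x0 (fun s => biased_weight (map wt s) * Psi s) zz').
Qed.

Lemma biased_mean1 z : {in z, forall x, 0 < wt x} ->
  biased_mean (fun=> 1) z = 1.
Proof.
move=> wz; rewrite -[RHS](@biased_weight_sum1 R _ (wt \o nth x0 z)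
  (iota 0 (size z)) (iota_uniq _ _))//; last first.
  by move=> i; rewrite mem_iota /= => iz; rewrite wz// mem_nth.
by apply: eq_bigr => t _; rewrite mulr1 -map_comp.
Qed.

Lemma biased_mean_ge0 Psi z : {in z, forall x, 0 < wt x} ->
  (forall s, 0 <= Psi s) -> 0 <= biased_mean Psi z.
Proof.
move=> wz Psi0; rewrite /biased_mean big_seq; apply: sumr_ge0 => t.
rewrite mem_permutations => tz; rewrite mulr_ge0//.
apply: biased_weight_ge0 => _ /mapP[x xz ->]; apply/ltW/wz.
by rewrite -(perm_mem (perm_map_nth x0 tz)).
Qed.

(** A factor that does not depend on the order can be taken out of the biased
    mean. *)
Lemma biased_meanMl (Th Psi : seq T -> R) z :
  (forall s s', perm_eq s s' -> Th s = Th s') ->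
  biased_mean (fun s => Th s * Psi s) z = Th z * biased_mean Psi z.
Proof.
move=> Thp; rewrite /biased_mean mulr_sumr big_seq [RHS]big_seq.
apply: eq_bigr => t; rewrite mem_permutations => tz.
by rewrite (Thp _ z) ?perm_map_nth// mulrCA.
Qed.

End BiasedMean.

(** Reading a tuple without repetition along all the permutations of its
    positions enumerates its arrangements. *)
Lemma big_perm_tuple (V : nmodType) (T : eqType) (n : nat) (t : n.-tuple T)
    (F : seq T -> V) : uniq t ->
  \sum_(s : 'S_n) F [seq tnth t (s i) | i <- enum 'I_n] =
  \sum_(x <- permutations t) F x.
Proof.
move=> ut; rewrite -big_enum/=.
rewrite -(big_map (fun s : 'S_n => [seq tnth t (s i) | i <- enum 'I_n]) xpredT F).
apply: perm_big; apply: uniq_perm.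
- rewrite map_inj_uniq ?enum_uniq// => s s' /eq_in_map ss'.
  apply/permP => i; apply: (tuple_uniqP _ ut).
  by apply: ss'; rewrite mem_enum.
- exact: permutations_uniq.
move=> x; rewrite mem_permutations; apply/mapP/tuple_permP => [[s _ ->]|[s ->]].
  by exists s; rewrite /= /image_mem.
by exists s; rewrite ?mem_enum.
Qed.

Lemma biased_kernelE (R : realType) (T : eqType) (x0 : T) (wt : T -> R)
    (y : seq T) (B : set (seq T)) :
  biased_kernel wt y B = biased_mean x0 wt (\1_B) y.
Proof.
rewrite /biased_kernel /biased_mean.
set G := fun t : seq nat =>
  biased_weight [seq wt x | x <- [seq nth x0 y i | i <- t]] *
    \1_B [seq nth x0 y i | i <- t].
have uio : uniq (iota_tuple (size y) 0) by rewrite /= iota_uniq.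
rewrite -[RHS](big_perm_tuple G uio); apply: eq_bigr => s _.
have rE : reorder s =
    [seq nth x0 y i |
       i <- [seq tnth (iota_tuple (size y) 0) (s j) | j <- enum 'I_(size y)]].
  rewrite /reorder -map_comp; apply: eq_map => j /=.
  by rewrite (tnth_nth x0)/= (tnth_nth 0%N)/= nth_iota// add0n.
rewrite /G -rE; congr (_ * _); rewrite /biased_perm_prob.
rewrite (biased_weight_ord (f := fun j => wt (tnth (in_tuple y) (s j)))).
  by rewrite /reorder -map_comp.
by rewrite big_tnth; exact: reindex_inj (@perm_inj _ s).
Qed.

(** * Compositions and ordered set partitions *)

(** The compositions of [n], built part by part; [f >= n] bounds the number of
    parts. *)
Fixpoint compositions_fuel (f n : nat) : seq (seq nat) :=
  if n is 0%N then [:: [::]] else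
  if f is f'.+1 then
    [seq k.+1 :: c | k <- iota 0 n, c <- compositions_fuel f' (n - k.+1)]
  else [::].

(** The compositions of [n]: all the lists of positive integers with sum [n]. *)
Definition compositions (n : nat) : seq (seq nat) := compositions_fuel n n.

Lemma compositions_fuelS f n : compositions_fuel f.+1 n.+1 =
  [seq k.+1 :: c | k <- iota 0 n.+1, c <- compositions_fuel f (n - k)].
Proof. by []. Qed.

Lemma mem_compositions_fuel f n c : (n <= f)%N ->
  (c \in compositions_fuel f n) = (0%N \notin c) && (sumn c == n).
Proof.
have aux c' : (c' \in [:: [::]]) = (0%N \notin c') && (sumn c' == 0%N).
  by rewrite mem_seq1; case: c' => [|[|k] c']//=; rewrite in_cons /= andbF.
elim: f n c => [|f IH] [|n] c nf //.
rewrite compositions_fuelS; apply/allpairsPdep/idP => [[k [c' []]]|].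
  rewrite mem_iota add0n /= => kn + ->.
  by rewrite IH 1?in_cons /=; lia.
case: c => [|[|k] c]//; rewrite in_cons /= => /andP[c0 /eqP sc].
exists k, c; split => //; first by rewrite (mem_iota 0 n.+1); lia.
by rewrite IH; [rewrite c0/=; lia|lia].
Qed.

Lemma mem_compositions n c :
  (c \in compositions n) = (0%N \notin c) && (sumn c == n).
Proof. exact: mem_compositions_fuel. Qed.

Lemma compositions_fuel_uniq f n : uniq (compositions_fuel f n).
Proof.
elim: f n => [|f IH] [|n] //; rewrite compositions_fuelS.
apply: allpairs_uniq_dep => [|k _|]; [exact: iota_uniq|exact: IH|].
by move=> [k c] [k' c'] _ _ /= [-> ->].
Qed.

Lemma compositions_uniq n : uniq (compositions n).
Proof. exact: compositions_fuel_uniq. Qed.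

Section OrderedPartitions.
Context (T : eqType).
Implicit Types (L s b : seq T) (ss : seq (seq T)).

(** The arrangements of the items of [L] cut into nonempty successive blocks:
    an ordered set partition of [L] with an order inside each block. *)
Definition cut_arrangements L : seq (seq (seq T)) :=
  [seq reshape c s | c <- compositions (size L), s <- permutations L].

Lemma mem_cut_arrangements L ss :
  (ss \in cut_arrangements L) = perm_eq (flatten ss) L && ([::] \notin ss).
Proof.
apply/allpairsP/andP => [[[c s] /= []]|[pss nss]].
  rewrite mem_compositions mem_permutations => /andP[c0 /eqP sc] sL ->.
  have szs : size s = sumn c by rewrite sc (perm_size sL).
  rewrite reshapeKr ?szs//; split=> //.
  apply: contra c0 => /(map_f size); rewrite -/(shape _).
  by rewrite reshapeKl ?szs.
exists (shape ss, flatten ss); rewrite /= flattenK mem_permutations; split=> //.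
rewrite mem_compositions -size_flatten (perm_size pss) eqxx andbT.
by apply: contra nss => /mapP[s sss /esym/size0nil <-].
Qed.

Lemma cut_arrangements_uniq L : uniq (cut_arrangements L).
Proof.
apply: allpairs_uniq; rewrite ?compositions_uniq ?permutations_uniq//.
move=> _ _ /allpairsP[[c s] /= [cn sL ->]] /allpairsP[[c' s'] /= [c'n s'L ->]] /= E.
move: cn c'n; rewrite !mem_compositions => /andP[_ /eqP cn] /andP[_ /eqP c'n].
move: sL s'L; rewrite !mem_permutations => /perm_size sL /perm_size s'L.
congr pair.
  by rewrite -(@reshapeKl _ c s) ?E ?reshapeKl// ?cn ?sL ?c'n ?s'L.
by rewrite -(@reshapeKr _ c s) ?E ?reshapeKr// ?cn ?sL ?c'n ?s'L.
Qed.

Lemma size_cut_arrangements L ss : ss \in cut_arrangements L ->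
  (size ss <= size L)%N.
Proof.
rewrite mem_cut_arrangements => /andP[/perm_size <- ]; elim: ss => //= b ss IH.
by rewrite in_cons negb_or size_cat => /andP[b0 /IH]; case: b b0 => //= *; lia.
Qed.

End OrderedPartitions.

Section BlockSums.
Context (R : realFieldType) (T : eqType) (y : T -> R).
Implicit Types (L s b : seq T) (ss : seq (seq T)) (Phi : seq (R * nat) -> R).

(** Total length of the block [b]. *)
Definition mass b : R := \sum_(x <- b) y x.

(** Length of the last interval of the block [b], 0 if [b] is empty. *)
Definition last_mass b : R := last 0 [seq y x | x <- b].

(** The bivariate sequence of the block masses and block sizes. *)
Definition blocks ss : seq (R * nat) := [seq (mass b, size b) | b <- ss].

Lemma mass_perm b b' : perm_eq b b' -> mass b = mass b'.
Proof. exact: perm_big. Qed.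

Lemma sum_last_mass_rot b m : (size b <= m)%N ->
  \sum_(r < m | (r < size b)%N) last_mass (rot r.+1 b) = mass b.
Proof.
move=> bm; rewrite -(big_ord_widen _ (fun r => last_mass (rot r.+1 b)) bm).
rewrite /mass -(big_map y xpredT id) (big_nth 0) size_map big_mkord.
apply: eq_bigr => r _; rewrite /last_mass map_rot /rot.
by rewrite (take_nth 0) ?size_map// last_cat last_rcons.
Qed.

(* [ss] with its block number [k] rotated by [r]. *)
Let rot_block k r ss := take k ss ++ rot r (nth [::] ss k) :: drop k.+1 ss.

Let split_block k ss : (k < size ss)%N ->
  ss = take k ss ++ nth [::] ss k :: drop k.+1 ss.
Proof. by move=> kss; rewrite -drop_nth// cat_take_drop. Qed.

Let take_rot_block k r ss : (k < size ss)%N -> take k (rot_block k r ss) = take k ss.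
Proof. by move=> kss; rewrite /rot_block take_size_cat// size_takel// ltnW. Qed.

Let drop_rot_block k r ss : (k < size ss)%N ->
  drop k (rot_block k r ss) = rot r (nth [::] ss k) :: drop k.+1 ss.
Proof. by move=> kss; rewrite /rot_block drop_size_cat// size_takel// ltnW. Qed.

Let nth_rot_block k r ss : (k < size ss)%N ->
  nth [::] (rot_block k r ss) k = rot r (nth [::] ss k).
Proof.
move=> kss; have := congr1 (fun z => nth [::] z 0) (drop_rot_block r kss).
by rewrite nth_drop addn0.
Qed.

Let dropS_rot_block k r ss : (k < size ss)%N ->
  drop k.+1 (rot_block k r ss) = drop k.+1 ss.
Proof.
move=> kss; have := congr1 behead (drop_rot_block r kss).
by rewrite /= -drop1 drop_drop add1n.
Qed.

Let size_rot_block k r ss : (k < size ss)%N -> size (rot_block k r ss) = size ss.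
Proof.
by move=> kss; rewrite [in RHS](split_block kss) !size_cat.
Qed.

Let blocks_rot_block k r ss : (k < size ss)%N ->
  blocks (rot_block k r ss) = blocks ss.
Proof.
move=> kss; rewrite /rot_block [in RHS](split_block kss) /blocks !map_cat /=.
by rewrite size_rot (mass_perm (b' := nth [::] ss k)) // perm_rot.
Qed.

Let average_block L k (A : seq (seq T) -> R) :
  (forall r ss, (k < size ss)%N -> A (rot_block k r ss) = A ss) ->
  \sum_(ss <- cut_arrangements L | (k < size ss)%N)
     A ss * last_mass (nth [::] ss k) =
  \sum_(ss <- cut_arrangements L | (k < size ss)%N)
     A ss * (mass (nth [::] ss k) / (size (nth [::] ss k))%:R).
Proof.
move=> Arot; pose sz ss := size (nth [::] ss k).
have szP ss : ss \in cut_arrangements L -> (k < size ss)%N ->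
    (0 < sz ss <= size L)%N.
  rewrite mem_cut_arrangements => /andP[/perm_size <- ss0] kss.
  rewrite lt0n size_eq0 (contraNneq _ ss0) => [|<-]; last exact: mem_nth.
  have -> : size (flatten ss) = (size (flatten (take k ss)) +
      (sz ss + size (flatten (drop k.+1 ss))))%N.
    by rewrite {1}(split_block kss) flatten_cat size_cat /= size_cat.
  by rewrite /sz; lia.
(* Each term is repeated once for each rotation of the block number [k]. *)
transitivity (\sum_(ss <- cut_arrangements L | (k < size ss)%N)
    \sum_(r < size L | (r < sz ss)%N)
      A ss * last_mass (nth [::] ss k) / (sz ss)%:R).
  rewrite big_seq_cond [RHS]big_seq_cond; apply: eq_bigr => ss /andP[ssL kss].
  have /andP[s0 sL] := szP _ ssL kss.
  rewrite -(big_ord_widen _ (fun=> _ / _) sL) sumr_const card_ord.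
  by rewrite -[RHS]mulr_natr divfK// pnatr_eq0 -lt0n.
rewrite (exchange_big_dep xpredT)//=.
transitivity (\sum_(r < size L) \sum_(ss <- cut_arrangements L |
    (k < size ss)%N && (r < sz ss)%N)
    A ss * last_mass (rot r.+1 (nth [::] ss k)) / (sz ss)%:R).
  apply: eq_bigr => r _.
  rewrite [LHS](@reindex_inj_in _ _ _ _
    (fun ss => if (k < size ss)%N then rot_block k r.+1 ss else ss)).
  - apply: eq_bigr => ss /andP[kss rss].
    by rewrite kss /sz nth_rot_block// Arot// size_rot.
  - exact: cut_arrangements_uniq.
  - move=> ss ss' _ _ /=.
    case: ifPn => kss; case: ifPn => kss' //.
    + move=> E; rewrite (split_block kss) (split_block kss').
      have := congr1 (take k) E; rewrite !take_rot_block// => ->.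
      have := congr1 (drop k) E; rewrite !drop_rot_block// => -[/rot_inj ->].
      by move=> ->.
    + by move=> E; move: kss'; rewrite -E size_rot_block// kss.
    + by move=> E; move: kss; rewrite E size_rot_block// kss'.
  - move=> ss ssL /andP[kss rss]; rewrite kss size_rot_block// kss.
    rewrite {1}/sz nth_rot_block// size_rot rss; split=> //.
    move: ssL; rewrite !mem_cut_arrangements /rot_block {1 2}(split_block kss).
    rewrite !mem_cat !in_cons !flatten_cat /= => /andP[pss nss].
    apply/andP; split; last first.
      by rewrite -[[::] == _]/(_ == _) eq_sym -size_eq0 size_rot size_eq0 eq_sym.
    by apply: perm_trans pss; rewrite perm_cat2l perm_cat2r perm_rot.
rewrite (exchange_big_dep (fun ss : seq (seq T) => (k < size ss)%N))/=; last first.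
  by move=> r ss _ /andP[].
rewrite big_seq_cond [RHS]big_seq_cond; apply: eq_bigr => ss /andP[ssL kss].
under eq_bigl do rewrite kss.
rewrite -mulr_suml -mulr_sumr sum_last_mass_rot ?mulrA//.
by have /andP[] := szP _ ssL kss.
Qed.

(** Rotating one block changes neither its mass nor its size, and makes each of
    its items the last one once: in a sum over all the arrangements, the last
    item of every block can be replaced by the mean of the block. *)
Lemma average_last_mass L Phi :
  \sum_(ss <- cut_arrangements L)
     (\prod_(b <- ss) last_mass b) * Phi (blocks ss) =
  \sum_(ss <- cut_arrangements L)
     (\prod_(b <- ss) (mass b / (size b)%:R)) * Phi (blocks ss).
Proof.
(* Interpolation: the first [k] blocks are already averaged. *)
pose G k := \sum_(ss <- cut_arrangements L)
  (\prod_(b <- take k ss) (mass b / (size b)%:R)) *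
  (\prod_(b <- drop k ss) last_mass b) * Phi (blocks ss).
have GS k : G k = G k.+1.
  rewrite /G (bigID (fun ss => (k < size ss)%N))
    [RHS](bigID (fun ss => (k < size ss)%N)) /=.
  congr (_ + _); last first.
    apply: eq_bigr => ss; rewrite -leqNgt => ssk.
    by rewrite !take_oversize ?drop_oversize// ltnW.
  pose A ss := (\prod_(b <- take k ss) (mass b / (size b)%:R)) *
    (\prod_(b <- drop k.+1 ss) last_mass b) * Phi (blocks ss).
  transitivity (\sum_(ss <- cut_arrangements L | (k < size ss)%N)
     A ss * last_mass (nth [::] ss k)).
    apply: eq_bigr => ss kss; rewrite (drop_nth [::] kss) big_cons /A.
    by rewrite mulrCA -!mulrA mulrC !mulrA.
  rewrite average_block; last first.
    by move=> r ss kss; rewrite /A take_rot_block// dropS_rot_block// blocks_rot_block.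
  apply: eq_bigr => ss kss; rewrite (take_nth [::] kss) -cats1 big_cat big_seq1 /A.
  by rewrite mulrAC; congr (_ * _); rewrite mulrAC.
transitivity (G 0%N).
  by apply: eq_bigr => ss _; rewrite take0 drop0 big_nil mul1r.
transitivity (G (size L)).
  by elim: (size L) => // k ->; exact: GS.
rewrite /G big_seq [RHS]big_seq; apply: eq_bigr => ss /size_cut_arrangements sL.
by rewrite take_oversize// drop_oversize// big_nil mulr1.
Qed.

Lemma big_cut_arrangements_size L (G : seq (seq T) -> R) :
  \sum_(ss <- cut_arrangements L) G ss =
  \sum_(m < (size L).+1) \sum_(ss <- cut_arrangements L | size ss == m) G ss.
Proof.
rewrite (exchange_big_dep xpredT)//= big_seq [RHS]big_seq.
apply: eq_bigr => ss /size_cut_arrangements; rewrite -ltnS => sL.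
by rewrite (big_pred1 (Ordinal sL))// => m; rewrite -val_eqE eq_sym.
Qed.

(** A sum over all the cut arrangements is unchanged when its terms are averaged
    over the orders of the blocks. *)
Lemma symmetrize_blocks L (G : seq (seq T) -> R) :
  \sum_(ss <- cut_arrangements L) G ss =
  \sum_(ss <- cut_arrangements L) (size ss)`!%:R^-1 *
    \sum_(t <- permutations (iota 0 (size ss))) G [seq nth [::] ss i | i <- t].
Proof.
rewrite big_cut_arrangements_size [RHS]big_cut_arrangements_size.
apply: eq_bigr => -[m /= _] _; pose I := permutations (iota 0 m).
have sI : size I = m`! by rewrite size_permutations ?iota_uniq// size_iota.
transitivity (m`!%:R^-1 * \sum_(t <- I)
    \sum_(ss <- cut_arrangements L | size ss == m) G [seq nth [::] ss i | i <- t]).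
  rewrite [X in _ * X](_ : _ = \sum_(t <- I)
    \sum_(ss <- cut_arrangements L | size ss == m) G ss); last first.
    rewrite big_seq [RHS]big_seq; apply: eq_bigr => t.
    rewrite mem_permutations => tm; rewrite -big_filter -[RHS]big_filter.
    apply/esym/(@reindex_inj_in _ _ xpredT).
    - exact/filter_uniq/cut_arrangements_uniq.
    - apply: map_nth_injective tm _ => ss.
      by rewrite mem_filter => /andP[/eqP].
    - move=> ss; rewrite !mem_filter => /andP[/eqP sm] ssL _; split=> //.
      move: ssL; rewrite size_map (perm_size tm) size_iota eqxx/=.
      rewrite -sm in tm; have pss := perm_map_nth [::] tm.
      rewrite !mem_cut_arrangements (perm_mem pss) => /andP[fss ->].
      by rewrite (perm_trans (perm_flatten pss)).
  rewrite big_const_seq count_predT iter_addr_0 sI -[X in _ * X]mulr_natl.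
  by rewrite mulKf// pnatr_eq0 -lt0n fact_gt0.
rewrite exchange_big/= mulr_sumr; apply: eq_bigr => ss /eqP sm.
by rewrite sm.
Qed.

(** The weight of [ss] in the measure, invariant under permutations of the
    blocks, that underlies both constructions. *)
Definition inv_sizes ss : R := \prod_(b <- ss) (size b)%:R^-1.

(** Against a weight invariant under permutations of the blocks, the factor
    [biased_weight] acts as a [wt]-biased ordering of the blocks. *)
Lemma biased_symmetrization L (wt : R * nat -> R) Psi :
  \sum_(ss <- cut_arrangements L)
    biased_weight [seq wt p | p <- blocks ss] * inv_sizes ss * Psi (blocks ss) =
  \sum_(ss <- cut_arrangements L)
    (size ss)`!%:R^-1 * inv_sizes ss * biased_mean (0, 0%N) wt Psi (blocks ss).
Proof.
rewrite symmetrize_blocks big_seq [RHS]big_seq; apply: eq_bigr => ss ssL.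
rewrite -mulrA; congr (_ * _); rewrite /biased_mean mulr_sumr size_map.
rewrite big_seq [RHS]big_seq; apply: eq_bigr => t.
rewrite mem_permutations => tss.
have -> : inv_sizes [seq nth [::] ss i | i <- t] = inv_sizes ss.
  exact: perm_big (perm_map_nth _ tss).
have -> : blocks [seq nth [::] ss i | i <- t] =
    [seq nth (0, 0%N) (blocks ss) i | i <- t].
  rewrite /blocks -map_comp; apply/eq_in_map => i.
  rewrite (perm_mem tss) mem_iota add0n /= => iss.
  by rewrite (nth_map [::]).
by rewrite -mulrA mulrCA.
Qed.

End BlockSums.

Section PathWeights.
Context (R : realFieldType) (T : eqType) (y : T -> R).
Implicit Types (L s b : seq T) (ss : seq (seq T)) (Psi : seq (R * nat) -> R).

(** Probability that the D-partition has the successive blocks [ss], given that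
    the intervals, from left to right, are those of the concatenation of [ss],
    with lengths [y]. *)
Definition pathD ss : R :=
  (\prod_(b <- ss) last_mass y b) * inv_tails [seq mass y b | b <- ss].

(** The same probability for the T-partition. *)
Definition pathT ss : R := inv_tails [seq (size b)%:R | b <- ss].

Lemma mass_flatten ss : mass y (flatten ss) = \sum_(b <- ss) mass y b.
Proof.
elim: ss => [|b ss IH]; rewrite ?big_nil /mass/= ?big_nil//.
by rewrite big_cat big_cons -IH.
Qed.

Lemma mass_gt0 b : {in b, forall x, 0 < y x} -> b != [::] -> 0 < mass y b.
Proof.
case: b => // x b yb _; rewrite /mass big_cons ltr_pwDl ?yb ?mem_head//.
by rewrite big_seq sumr_ge0// => z zb; rewrite ltW// yb// inE zb orbT.
Qed.

(** Sum of [Psi] over the partitions of [L] into unordered blocks, weighted by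
    [inv_sizes], with the blocks put in [wt]-biased order; the factorial makes up
    for the enumeration of all the orders of the blocks. *)
Definition biased_sum (wt : R * nat -> R) L Psi : R :=
  \sum_(ss <- cut_arrangements L)
    (size ss)`!%:R^-1 * inv_sizes R ss *
    biased_mean (0, 0%N) wt Psi (blocks y ss).

Lemma sum_pathD L Psi :
  \sum_(ss <- cut_arrangements L) pathD ss * Psi (blocks y ss) =
  biased_sum (fun p => p.1) L Psi.
Proof.
rewrite /biased_sum -biased_symmetrization.
pose Phi z := inv_tails [seq p.1 | p <- z] * Psi z.
have E ss : [seq mass y b | b <- ss] = [seq p.1 | p <- blocks y ss].
  by rewrite /blocks -map_comp.
transitivity (\sum_(ss <- cut_arrangements L)
     (\prod_(b <- ss) last_mass y b) * Phi (blocks y ss)).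
  by apply: eq_bigr => ss _; rewrite /pathD E mulrA.
rewrite average_last_mass; apply: eq_bigr => ss _.
rewrite /Phi /biased_weight big_split/= -E big_map /inv_sizes.
by rewrite !mulrA; congr (_ * _); rewrite mulrAC.
Qed.

Lemma sum_pathT L Psi :
  \sum_(ss <- cut_arrangements L) pathT ss * Psi (blocks y ss) =
  biased_sum (fun p => p.2%:R) L Psi.
Proof.
rewrite /biased_sum -biased_symmetrization big_seq [RHS]big_seq.
apply: eq_bigr => ss; rewrite mem_cut_arrangements => /andP[_ ss0].
congr (_ * _); have -> : [seq (p.2%:R : R) | p <- blocks y ss] =
    [seq (size b)%:R | b <- ss] by rewrite /blocks -map_comp.
rewrite /biased_weight mulrAC /inv_sizes big_map -big_split/=.
rewrite big_seq big1 ?mul1r// => b bss; rewrite divff// pnatr_eq0 size_eq0.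
by apply: contraNneq ss0 => <-.
Qed.

Section Positive.
Variable L : seq T.
Hypothesis yL : {in L, forall x, 0 < y x}.

Lemma blocks_gt0 ss : ss \in cut_arrangements L ->
  {in blocks y ss, forall p, 0 < p.1 /\ (0 < p.2)%N}.
Proof.
rewrite mem_cut_arrangements => /andP[/perm_mem pss ss0] _ /mapP[b bss ->] /=.
have b0 : b != [::] by apply: contraNneq ss0 => <-.
split; last by rewrite lt0n size_eq0.
by apply: mass_gt0 => // x xb; apply: yL; rewrite -pss; apply/flattenP; exists b.
Qed.

Variable wt : R * nat -> R.
Hypothesis wt_gt0 : forall p, 0 < p.1 /\ (0 < p.2)%N -> 0 < wt p.

(** The sum of a function of the unordered blocks does not depend on the bias. *)
Lemma biased_sum_symmetric Th : (forall z z', perm_eq z z' -> Th z = Th z') ->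
  biased_sum wt L Th = \sum_(ss <- cut_arrangements L)
    (size ss)`!%:R^-1 * inv_sizes R ss * Th (blocks y ss).
Proof.
move=> ThP; rewrite /biased_sum big_seq [RHS]big_seq; apply: eq_bigr => ss ssL.
congr (_ * _); rewrite -[RHS]mulr1.
rewrite -(@biased_mean1 _ _ (0, 0%N) wt (blocks y ss)); last first.
  by move=> p pss; apply: wt_gt0; exact: blocks_gt0 pss.
by rewrite -biased_meanMl//; apply: eq_bigr => t _; rewrite mulr1.
Qed.

(** Given the unordered blocks, their order is [wt]-biased. *)
Lemma biased_sum_mean Th Psi : (forall z z', perm_eq z z' -> Th z = Th z') ->
  biased_sum wt L (fun z => Th z * Psi z) =
  biased_sum wt L (fun z => Th z * biased_mean (0, 0%N) wt Psi z).
Proof.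
move=> ThP; rewrite [RHS]biased_sum_symmetric; last first.
  by move=> z z' zz'; rewrite (ThP _ _ zz') (biased_mean_perm _ _ _ zz').
by apply: eq_bigr => ss _; rewrite biased_meanMl.
Qed.

End Positive.
End PathWeights.

Section ShapeWeights.
Context (R : realFieldType) (T : eqType) (y : T -> R).
Implicit Types (L s : seq T) (c : seq nat).

(* For a weight [W] of the list after the position [k] whose sum over all orders
   depends on the number of items only, the item at position [k] contributes its
   mean. *)
Let fixed_first_block (W : seq T -> R) (C : R) m k L :
  uniq L -> size L = (k.+1 + m)%N ->
  (forall L', uniq L' -> {subset L' <= L} -> size L' = m ->
    \sum_(s <- permutations L') W s = m`!%:R * C) ->
  \sum_(s <- permutations L) nth 0 [seq y x | x <- s] k * W (drop k.+1 s) =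
  mass y L * (size L).-1`!%:R * C.
Proof.
elim: k L => [|k IH] L uL sL HW; rewrite big_permutations_rem ?sL//.
  rewrite /mass -mulrA mulr_suml big_seq [RHS]big_seq; apply: eq_bigr => x xL.
  rewrite /= (eq_bigr (fun s => y x * W s)); last by move=> s _; rewrite drop0.
  rewrite -mulr_sumr HW ?rem_uniq//; first by move=> z /mem_rem.
  by rewrite size_rem// sL.
have sL2 : size L = (k + m).+2 by rewrite sL; lia.
transitivity (\sum_(x <- L) (mass y L - y x) * ((k + m)`!%:R * C)).
  rewrite big_seq [RHS]big_seq; apply: eq_bigr => x xL /=.
  rewrite IH ?rem_uniq ?size_rem ?sL2//=; last first.
    by move=> L' uL' L'L; apply: HW => // z /L'L /mem_rem.
  rewrite -mulrA; congr (_ * _); rewrite /mass (perm_big _ (perm_to_rem xL)).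
  by rewrite big_cons addrC addKr.
rewrite -mulr_suml mulrA; congr (_ * _); rewrite sumrB big_const_seq count_predT.
rewrite iter_addr_0 sL2 -/(mass y L) mulrSr addrK /= factS natrM mulrA.
by congr (_ * _); rewrite mulr_natr.
Qed.

(** Averaged over all the orders of [L], the probability that the D-partition
    has shape [c] is the product of the reciprocals of the tail sums of [c], as
    for the T-partition. *)
Lemma sum_pathD_shape c L : uniq L -> {in L, forall x, 0 < y x} ->
  c \in compositions (size L) ->
  \sum_(s <- permutations L) pathD y (reshape c s) =
  (size L)`!%:R * inv_tails [seq k%:R | k <- c].
Proof.
elim: c L => [|k c IH] L uL yL; rewrite mem_compositions.
  move=> /= /eqP/esym/size0nil ->.
  by rewrite big_seq1 /pathD/= big_nil !mulr1.
rewrite in_cons negb_or /= => /andP[/andP[k0 c0] /eqP sL].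
case: k k0 sL => // k _ sL.
pose W s := pathD y (reshape c s).
have WE L' : uniq L' -> {subset L' <= L} -> size L' = sumn c ->
    \sum_(s <- permutations L') W s =
    (sumn c)`!%:R * inv_tails [seq (j%:R : R) | j <- c].
  move=> uL' L'L sL'; rewrite -sL'; apply: IH => //.
    by move=> x /L'L; exact: yL.
  by rewrite mem_compositions c0 sL' eqxx.
have L0 : L != [::] by rewrite -size_eq0 -sL.
have mL : mass y L != 0 by rewrite gt_eqF// mass_gt0.
transitivity ((mass y L)^-1 * \sum_(s <- permutations L)
    nth 0 [seq y x | x <- s] k * W (drop k.+1 s)).
  rewrite mulr_sumr big_seq [RHS]big_seq; apply: eq_bigr => s.
  rewrite mem_permutations => ps; rewrite /pathD /= !big_cons.
  have -> : \sum_(j <- [seq mass y b | b <- reshape c (drop k.+1 s)]) j =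
      mass y (drop k.+1 s).
    rewrite big_map -mass_flatten reshapeKr// size_drop (perm_size ps) -sL.
    by rewrite addKn.
  have -> : last_mass y (take k.+1 s) = nth 0 [seq y x | x <- s] k.
    rewrite /last_mass map_take (take_nth 0) ?last_rcons// size_map.
    by rewrite (perm_size ps) -sL; lia.
  have -> : mass y (take k.+1 s) + mass y (drop k.+1 s) = mass y L.
    by rewrite /mass -big_cat cat_take_drop; exact: perm_big.
  by rewrite [in LHS]mulrCA !mulrA.
rewrite (fixed_first_block uL (esym sL) WE) -mulrA mulKf//= big_cons big_map.
have -> : k.+1%:R + \sum_(j <- c) j%:R = (size L)%:R :> R.
  by rewrite -sL natrD sumnE natr_sum.
have [p pL] : exists p, size L = p.+1 by exists (k + sumn c)%N; rewrite -sL.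
by rewrite pL/= factS natrM [RHS]mulrACA divff ?mul1r// pnatr_eq0.
Qed.

Lemma pathT_reshape c s : c \in compositions (size s) ->
  pathT R (reshape c s) = inv_tails [seq k%:R | k <- c].
Proof.
rewrite mem_compositions => /andP[_ /eqP sc].
rewrite /pathT -[in RHS](@reshapeKl _ c s) ?sc// /shape -map_comp.
by congr inv_tails.
Qed.

(** The T-chain reaches 1: the probabilities of its shapes add up to 1. *)
Lemma sum_compositions_inv_tails n :
  \sum_(c <- compositions n) inv_tails [seq (k%:R : R) | k <- c] = 1.
Proof.
suff H f m : (m <= f)%N ->
    \sum_(c <- compositions_fuel f m) inv_tails [seq (k%:R : R) | k <- c] = 1.
  exact: H.
elim: f m => [|f IH] [|m] mf //; do ?by rewrite big_seq1.
rewrite compositions_fuelS big_allpairs_dep.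
transitivity (\sum_(k <- iota 0 m.+1) (m.+1%:R : R)^-1); last first.
  rewrite big_const_seq count_predT iter_addr_0 size_iota -[LHS]mulr_natl.
  by rewrite divff// pnatr_eq0.
rewrite big_seq [RHS]big_seq; apply: eq_bigr => k; rewrite mem_iota => km.
rewrite -[RHS]mulr1 -[X in _ = _ * X](IH (m - k)%N); last by lia.
rewrite mulr_sumr big_seq [RHS]big_seq; apply: eq_bigr => c.
rewrite mem_compositions_fuel; last by lia.
move=> /andP[_ /eqP sc]; rewrite /= big_cons big_map; congr (_^-1 * _).
have -> : \sum_(j <- c) j%:R = (sumn c)%:R :> R by rewrite sumnE natr_sum.
by rewrite sc -natrD; congr (_%:R); lia.
Qed.

End ShapeWeights.

(** * Measure-theoretic tools *)

Lemma measurable_preimage d1 d2 (T1 : measurableType d1) (T2 : measurableType d2)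
  (f : T1 -> T2) (A : set T2) : measurable_fun setT f -> measurable A ->
  measurable (f @^-1` A).
Proof. by move=> mf mA; rewrite -[X in measurable X]setTI; exact: mf. Qed.

Section Density.
Context d (Omega : measurableType d) (R : realType)
  (P : {measure set Omega -> \bar R}).
Context dS (S : measurableType dS) (Z : Omega -> S).
Hypothesis mZ : measurable_fun setT Z.
Local Open Scope ereal_scope.

Import HBNNSimple.

(* The identity for the simple functions that increase to [g] passes to the
   limit by monotone convergence. *)
Let eq_integral_given_ge0 (p q : Omega -> R) (g : S -> R) :
  measurable_fun setT p -> measurable_fun setT q ->
  (forall w, (0 <= p w)%R) -> (forall w, (0 <= q w)%R) ->
  (forall A, measurable A -> \int[P]_(w in Z @^-1` A) (p w)%:E =
                             \int[P]_(w in Z @^-1` A) (q w)%:E) ->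
  measurable_fun setT g -> (forall z, (0 <= g z)%R) ->
  \int[P]_w (p w * g (Z w))%:E = \int[P]_w (q w * g (Z w))%:E.
Proof.
move=> mp mq p0 q0 pq mg g0.
have mEg : measurable_fun setT (EFin \o g) by exact/measurable_EFinP.
pose h := nnsfun_approx measurableT mEg.
have gE z : (h n z)%:E @[n --> \oo] --> (g z)%:E.
  by apply: (cvg_nnsfun_approx measurableT mEg) => // t _; rewrite lee_fin.
have mhZ n : measurable_fun setT (h n \o Z) by exact: measurableT_comp.
have limE (r : Omega -> R) : measurable_fun setT r -> (forall w, (0 <= r w)%R) ->
    \int[P]_w (r w * g (Z w))%:E =
    limn (fun n => \int[P]_w (r w * h n (Z w))%:E).
  move=> mr r0; rewrite -monotone_convergence//.
  - apply: eq_integral => w _; apply/esym/cvg_lim => //.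
    under eq_fun do rewrite EFinM.
    by rewrite EFinM; apply: cvgeZl.
  - move=> n; apply/measurable_EFinP/measurable_funM => //; exact: (mhZ n).
  - by move=> n w _; rewrite lee_fin mulr_ge0.
  - move=> w _ m n mn; rewrite lee_fin ler_wpM2l//.
    by have /lefP/(_ (Z w)) := nd_nnsfun_approx measurableT mEg mn.
rewrite (limE p)// (limE q)//; congr (limn _); apply/funext => n.
have sumE (r : Omega -> R) : measurable_fun setT r -> (forall w, (0 <= r w)%R) ->
    \int[P]_w (r w * h n (Z w))%:E = \sum_(y \in range (h n))
      y%:E * \int[P]_(w in Z @^-1` (h n @^-1` [set y])) (r w)%:E.
  move=> mr r0.
  have my y : measurable (Z @^-1` (h n @^-1` [set y]))
    by apply: measurable_preimage => //; exact: measurable_sfunP.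
  transitivity (\int[P]_w \sum_(y \in range (h n))
      (y * (r w * \1_(Z @^-1` (h n @^-1` [set y])) w))%:E).
    apply: eq_integral => w _; rewrite fimfunE fsumEFin//; congr EFin.
    by rewrite mulr_fsumr; apply: eq_fsbigr => y _; rewrite mulrCA.
  rewrite ge0_integral_fsum//=; last 2 first.
  - move=> y; apply/measurable_EFinP/measurable_funM => //.
    by apply: measurable_funM => //; exact: measurable_indic.
  - move=> y w _; rewrite lee_fin.
    rewrite mulrCA mulr_ge0//; apply: nnfun_muleindic_ge0.
  apply: eq_fsbigr => y; rewrite inE => -[z _ yE].
  under eq_integral do rewrite EFinM.
  rewrite ge0_integralZl//=; last 3 first.
  - by apply/measurable_EFinP/measurable_funM => //; exact: measurable_indic.
  - by move=> w _; rewrite lee_fin mulr_ge0.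
  - by rewrite lee_fin -yE.
  congr (_ * _); under eq_integral do rewrite EFinM.
  rewrite [RHS]integral_mkcond; apply: eq_integral => w _.
  by rewrite patchE indicE; case: ifPn; rewrite ?mule1 ?mule0.
by rewrite sumE// sumE//; apply: eq_fsbigr => y _; rewrite pq.
Qed.

(** Two nonnegative functions with the same integral over every event
    determined by [Z], that is with the same conditional expectation given
    [Z], have the same integral against every function of [Z]. *)
Lemma eq_integral_given (p q : Omega -> R) (g : S -> R) :
  measurable_fun setT p -> measurable_fun setT q ->
  (forall w, (0 <= p w)%R) -> (forall w, (0 <= q w)%R) ->
  (forall A, measurable A -> \int[P]_(w in Z @^-1` A) (p w)%:E =
                             \int[P]_(w in Z @^-1` A) (q w)%:E) ->
  measurable_fun setT g -> (forall w, (0 <= g (Z w))%R) ->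
  \int[P]_w (p w * g (Z w))%:E = \int[P]_w (q w * g (Z w))%:E.
Proof.
move=> mp mq p0 q0 pq mg g0.
have := @eq_integral_given_ge0 p q (fun z => `|g z|)%R mp mq p0 q0 pq.
rewrite (_ : (fun w => (p w * `|g (Z w)|)%:E) = fun w => (p w * g (Z w))%:E).
  rewrite (_ : (fun w => (q w * `|g (Z w)|)%:E) = fun w => (q w * g (Z w))%:E).
    by apply => //; exact: measurableT_comp.
  by apply/funext => w; rewrite ger0_norm.
by apply/funext => w; rewrite ger0_norm.
Qed.

End Density.

Section Cover.
Context d (Omega : measurableType d) (R : realType) (P : probability Omega R).
Local Open Scope ereal_scope.

(** Disjoint events whose probabilities add up to 1 split every integral. *)
Lemma integral_cover (I : eqType) (s : seq I) (F : I -> set Omega)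
    (f : Omega -> R) :
  (forall i, measurable (F i)) -> uniq s -> trivIset [set` s] F ->
  \sum_(i <- s) P (F i) = 1 ->
  measurable_fun setT f -> (forall w, (0 <= f w)%R) ->
  \int[P]_w (f w)%:E = \sum_(i <- s) \int[P]_w (\1_(F i) w * f w)%:E.
Proof.
move=> mF us tF PF mf f0; pose D := \big[setU/set0]_(i <- s) F i.
have mD : measurable D by exact: bigsetU_measurable.
have PD : P D = 1.
  rewrite -[LHS]mul1e -integral_cst// ge0_integral_bigsetU// -[RHS]PF.
  by apply: eq_bigr => i _; rewrite integral_cst// mul1e.
have PCD : P (~` D) = 0 by rewrite probability_setC// PD subee.
have mfE : measurable_fun setT (EFin \o f) by exact/measurable_EFinP.
rewrite (ge0_negligible_integral (measurableC mD))//; last first.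
  by move=> w _; rewrite lee_fin.
rewrite setTD setCK ge0_integral_bigsetU//; last 2 first.
- exact: measurable_funTS.
- by move=> w _; rewrite lee_fin.
apply: eq_bigr => i _; rewrite [LHS]integral_mkcond; apply: eq_integral => w _.
by rewrite patchE indicE; case: ifPn; rewrite ?mul1r ?mul0r.
Qed.

End Cover.

(** Two measures on a product, one of them finite, that agree on rectangles are
    equal. *)
Lemma measure_eq_rectangles d1 d2 (T1 : measurableType d1)
    (T2 : measurableType d2) (R : realType)
    (m1 m2 : {measure set (T1 * T2) -> \bar R}) :
  (m1 setT < +oo)%E ->
  (forall A B, measurable A -> measurable B -> m1 (A `*` B) = m2 (A `*` B)) ->
  forall C, measurable C -> m1 C = m2 C.
Proof.
move=> m1oo m12 C mC.
apply: (measure_unique [set A `*` B | A in measurable & B in measurable]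
  (fun=> setT)) => //.
- by rewrite measurable_prod_measurableType.
- move=> _ _ [A1 mA1 [B1 mB1 <-]] [A2 mA2 [B2 mB2 <-]].
  exists (A1 `&` A2); first exact: measurableI.
  by exists (B1 `&` B2); [exact: measurableI|rewrite setXI].
- by move=> _; exists setT => //; exists setT => //; rewrite setXTT.
- by rewrite bigcup_const//; exists 0%N.
- by move=> _ [A mA [B mB <-]]; exact: m12.
Qed.

Lemma measurable_fun_inv d (T : measurableType d) (R : realType) (f : T -> R) :
  measurable_fun setT f -> measurable_fun setT (fun x => (f x)^-1).
Proof.
move=> mf; rewrite (_ : (fun _ => _) = fun x => f x * (f x ^+ 2) `^ (-1)).
  apply: measurable_funM => //.
  apply: (@measurableT_comp _ _ _ _ _ _ (fun y : R => y `^ (-1))).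
    exact: measurable_powR.
  exact: measurable_funX.
(* [x^-1 = x * (x ^+ 2)^-1] also holds at 0, where both sides are 0. *)
apply/funext => x; rewrite powR_inv1 ?sqr_ge0// expr2 invfM mulrA.
by have [->|fx0] := eqVneq (f x) 0; rewrite ?invr0 ?mulr0// divff// mul1r.
Qed.

Lemma measurable_card d (T : measurableType d) n (D : 'I_n -> T -> bool) :
  (forall i, measurable_fun setT (D i)) ->
  measurable_fun setT (fun x => #|[set i | D i x]%SET| : nat).
Proof.
move=> mD; rewrite (_ : (fun _ => _) = fun x => (\sum_(i < n) D i x)%N); last first.
  by apply/funext => x; rewrite -sum1dep_card big_mkcond.
elim: (index_enum _) => [|i r IH].
  by under eq_fun do rewrite big_nil; exact: measurable_cst.
under eq_fun do rewrite big_cons; apply: measurable_fun_addn => //.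
rewrite (_ : (fun x => nat_of_bool _) = fun x => if D i x then 1%N else 0%N)//.
by apply: measurable_fun_ifT => //; exact: mD.
Qed.

Section SeqMeasurability.
Context dS (S : measurableType dS).

(** Random sequences, measurable for the sigma-algebra of the disjoint union of
    the powers of [S]. *)
Definition seq_random d (Omega : measurableType d) (X : Omega -> seq S) : Prop :=
  forall A, seq_measurable A -> measurable (X @^-1` A).

(** Real functions of a finite sequence that are measurable for that
    sigma-algebra. *)
Definition seq_mfun (R : realType) (Psi : seq S -> R) : Prop :=
  forall m, measurable_fun setT (fun t : m.-tuple S => Psi t).

Section Random.
Context d (Omega : measurableType d) (R : realType).
Implicit Types (X : Omega -> seq S) (Psi : seq S -> R) (A : set (seq S)).

Lemma measurable_seq_mfun Psi X : seq_mfun Psi -> seq_random X ->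
  measurable_fun setT (fun w => Psi (X w)).
Proof.
move=> mPsi mX _ B mB; rewrite setTI.
apply: (mX (Psi @^-1` B)) => m; rewrite -[X in measurable X]setTI.
exact: mPsi.
Qed.

Lemma measurable_map_tuple (J : Type) (p : seq J) (h : J -> Omega -> S) :
  (forall j, measurable_fun setT (h j)) ->
  measurable_fun setT (fun w => map_tuple (h^~ w) (in_tuple p)).
Proof.
move=> mh; apply/measurable_fun_tnthP => i.
rewrite (_ : _ \o _ = h (tnth (in_tuple p) i))//.
by apply/funext => w /=; rewrite tnth_map.
Qed.

Lemma measurable_seq_map (J : Type) (p : seq J) (h : J -> Omega -> S) A :
  (forall j, measurable_fun setT (h j)) -> seq_measurable A ->
  measurable [set w | A [seq h j w | j <- p]].
Proof.
move=> mh mA; have := measurable_map_tuple (p := p) mh measurableT (mA (size p)).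
by rewrite setTI.
Qed.

Lemma measurable_seq_mfun_map (J : Type) (p : seq J) (h : J -> Omega -> S) Psi :
  (forall j, measurable_fun setT (h j)) -> seq_mfun Psi ->
  measurable_fun setT (fun w => Psi [seq h j w | j <- p]).
Proof.
move=> mh mPsi _ B mB; rewrite setTI.
apply: (@measurable_seq_map J p h (Psi @^-1` B)) => // m.
by rewrite -[X in measurable X]setTI; exact: mPsi.
Qed.

Lemma seq_random_iota (N : Omega -> nat) (h : nat -> Omega -> S) :
  (forall m, measurable [set w | N w = m]) ->
  (forall j, measurable_fun setT (h j)) ->
  seq_random (fun w => [seq h j w | j <- iota 0 (N w)]).
Proof.
move=> mN mh A mA.
rewrite (_ : _ @^-1` _ = \bigcup_m ([set w | N w = m] `&`
    [set w | A [seq h j w | j <- iota 0 m]])).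
  by apply: bigcupT_measurable => m; apply: measurableI => //; exact: measurable_seq_map.
by apply/seteqP; split => [w Aw|w [m _ [/= <-]]]; first by exists (N w).
Qed.

End Random.

Section Functions.
Context (R : realType).
Implicit Types (Psi : seq S -> R) (A : set (seq S)).

Lemma seq_mfun_indic A : seq_measurable A -> seq_mfun (\1_A : seq S -> R).
Proof.
move=> mA m; rewrite (_ : (fun _ => _) = \1_[set t : m.-tuple S | A t])//.
by apply: measurable_indic; exact: mA.
Qed.

Lemma seq_mfunM Psi1 Psi2 : seq_mfun Psi1 -> seq_mfun Psi2 ->
  seq_mfun (fun z => Psi1 z * Psi2 z).
Proof. by move=> m1 m2 m; apply: measurable_funM; [exact: m1|exact: m2]. Qed.

Lemma measurable_nth (x0 : S) m j :
  measurable_fun setT (fun t : m.-tuple S => nth x0 t j).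
Proof.
have [jm|mj] := ltnP j m.
  rewrite (_ : (fun _ => _) = @tnth m S ^~ (Ordinal jm)).
    exact: measurable_tnth.
  by apply/funext => t; rewrite (tnth_nth x0).
rewrite (_ : (fun _ => _) = cst x0)//.
by apply/funext => t; rewrite nth_default// size_tuple.
Qed.

End Functions.
End SeqMeasurability.

Lemma seq_measurable_map d d' (S : measurableType d) (S' : measurableType d')
    (f : S -> S') (A : set (seq S')) : measurable_fun setT f ->
  seq_measurable A -> seq_measurable [set z | A [seq f x | x <- z]].
Proof.
move=> mf mA m.
rewrite (_ : [set _ | _] = [set t : m.-tuple S | A [seq f (tnth t i) | i <- enum 'I_m]]).
  apply: (measurable_seq_map _ (h := fun i (t : m.-tuple S) => f (tnth t i))) => // i.
  by apply: measurableT_comp => //; exact: measurable_tnth.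
by apply/seteqP; split => t /=; rewrite (map_comp f (tnth t)) map_tnth_enum.
Qed.

Section WeightMeasurability.
Context d (Omega : measurableType d) (R : realType) (J : Type).
Implicit Types (p : seq J) (h : J -> Omega -> R).

Lemma measurable_inv_tails p h : (forall j, measurable_fun setT (h j)) ->
  measurable_fun setT (fun w => inv_tails [seq h j w | j <- p]).
Proof.
move=> mh; elim: p => [|j p IH] /=; first exact: measurable_cst.
apply: measurable_funM => //; apply: measurable_fun_inv.
under eq_fun do rewrite big_cons big_map.
by apply: measurable_funD => //; exact: measurable_sum.
Qed.

Lemma measurable_biased_weight p h : (forall j, measurable_fun setT (h j)) ->
  measurable_fun setT (fun w => biased_weight [seq h j w | j <- p]).
Proof.
move=> mh; apply: measurable_funM; last exact: measurable_inv_tails.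
elim: p => [|j p IH] /=; last first.
  under eq_fun do rewrite big_cons.
  exact: measurable_funM.
under eq_fun do rewrite big_nil.
exact: measurable_cst.
Qed.

End WeightMeasurability.

Lemma seq_mfun_biased_mean d (S : measurableType d) (R : realType) (x0 : S)
    (wt : S -> R) (Psi : seq S -> R) : measurable_fun setT wt ->
  seq_mfun Psi -> seq_mfun (biased_mean x0 wt Psi).
Proof.
move=> mwt mPsi m; rewrite /biased_mean.
under eq_fun do rewrite size_tuple.
apply: measurable_sum => p; apply: measurable_funM.
  under eq_fun do rewrite -map_comp.
  apply: (measurable_biased_weight _ (h := fun j (t : m.-tuple S) => wt (nth x0 t j))).
  by move=> j; apply: measurableT_comp => //; exact: measurable_nth.
apply: (measurable_seq_mfun_map _ (h := fun j (t : m.-tuple S) => nth x0 t j)) => // j.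
exact: measurable_nth.
Qed.

Section SortMeasurability.
Context dS (S : measurableType dS) (leT : rel S).
Hypothesis mle : measurable_fun setT (fun p : S * S => leT p.1 p.2).

Lemma measurable_sorted d (Omega : measurableType d) (J : Type) (p : seq J)
    (h : J -> Omega -> S) : (forall j, measurable_fun setT (h j)) ->
  measurable_fun setT (fun w => sorted leT [seq h j w | j <- p]).
Proof.
move=> mh; case: p => [|j p] /=; first exact: measurable_cst.
elim: p j => [|i p IH] j /=; first exact: measurable_cst.
apply: measurable_and; last exact: IH.
apply: (measurableT_comp mle (g := fun w => (h j w, h i w))).
exact: measurable_fun_pair.
Qed.

Hypotheses (le_total : total leT) (le_trans : transitive leT)
  (le_anti : antisymmetric leT).

Lemma seq_measurable_sort (A : set (seq S)) :
  seq_measurable A -> seq_measurable [set z | A (sort leT z)].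
Proof.
move=> mA m; pose x0 : S := point.
pose h j (t : m.-tuple S) := nth x0 t j.
have mh j : measurable_fun setT (h j) by exact: measurable_nth.
rewrite (_ : [set _ | _] = \big[setU/set0]_(p <- permutations (iota 0 m))
  ([set t | sorted leT [seq h j t | j <- p]] `&`
   [set t | A [seq h j t | j <- p]])).
  apply: bigsetU_measurable => p _; apply: measurableI.
    have := measurable_sorted p mh measurableT (_ : measurable [set true]).
    by rewrite setTI; apply.
  exact: measurable_seq_map.
rewrite -bigcup_seq; apply/seteqP; split => [t At|t [p /= pm [ps Ap]]] /=.
  have /(perm_iotaP x0)[p pm sE] : perm_eq (sort leT t) t by rewrite perm_sort.
  exists p => /=; first by rewrite mem_permutations -(size_tuple t).
  by split; rewrite /= /h -sE//; exact: sort_sorted.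
rewrite /= (_ : sort _ _ = [seq h j t | j <- p])//.
rewrite -[RHS](sorted_sort le_trans ps).
apply/perm_sortP => //; rewrite perm_sym; apply: perm_map_nth.
by rewrite size_tuple -mem_permutations.
Qed.

End SortMeasurability.

Section Ranking.
Context (R : realType).

Lemma longer_total : total (@longer R).
Proof.
by move=> p q; rewrite /longer; case: ltgtP => //= _; exact: leq_total.
Qed.

Lemma longer_trans : transitive (@longer R).
Proof.
move=> q p r; rewrite /longer.
move=> /orP[qp|/andP[/eqP qp qp2]] /orP[rq|/andP[/eqP rq rq2]].
- by rewrite (lt_trans rq qp).
- by rewrite rq qp.
- by rewrite -qp rq.
- by rewrite rq qp eqxx (leq_trans rq2 qp2) orbT.
Qed.

Lemma longer_anti : antisymmetric (@longer R).
Proof.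
move=> [p1 p2] [q1 q2]; rewrite /longer /=; case: ltgtP => //= -> /andP[pq qp].
by congr pair; apply/anti_leq; rewrite qp pq.
Qed.

Lemma sort_longer_perm (z z' : seq (R * nat)) :
  perm_eq z z' -> sort (@longer R) z = sort (@longer R) z'.
Proof.
by move/(perm_sortP longer_total longer_trans longer_anti).
Qed.

Lemma measurable_longer :
  measurable_fun setT (fun p : (R * nat) * (R * nat) => longer p.1 p.2).
Proof.
have m1 (f : (R * nat) * (R * nat) -> R * nat) : measurable_fun setT f ->
    measurable_fun setT (fst \o f) by move=> mf; exact: measurableT_comp.
have m2 (f : (R * nat) * (R * nat) -> R * nat) : measurable_fun setT f ->
    measurable_fun setT (snd \o f) by move=> mf; exact: measurableT_comp.
apply: measurable_or.
  exact: (measurable_fun_ltr (m1 _ measurable_snd) (m1 _ measurable_fst)).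
apply: measurable_and.
  exact: (measurable_fun_eqr (m1 _ measurable_snd) (m1 _ measurable_fst)).
exact: (measurable_fun_leq (m2 _ measurable_snd) (m2 _ measurable_fst)).
Qed.

Lemma seq_measurable_ranked (A : set (seq (R * nat))) :
  seq_measurable A -> seq_measurable [set z | A (sort (@longer R) z)].
Proof.
apply: (seq_measurable_sort measurable_longer).
- exact: longer_total.
- exact: longer_trans.
- exact: longer_anti.
Qed.

End Ranking.

Section PairLaws.
Context d (Omega : measurableType d) (R : realType) (P : probability Omega R).
Context dS (S : measurableType dS) (Z : Omega -> S).
Context dV (V : measurableType dV).
Hypothesis mZ : measurable_fun setT Z.
Local Open Scope ereal_scope.

(** If, on [H1], a product rule expresses the law of [(Z, X)] on rectangles as a
    mixture of the laws of the pairs [(Z, Y k)] on [H2], it does so on every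
    event. *)
Lemma pair_law_mixture (H1 H2 : set Omega) (X : Omega -> V) (N : nat)
    (r : nat -> R) (Y : nat -> Omega -> V) :
  measurable H1 -> measurable H2 -> measurable_fun setT X ->
  (forall k, measurable_fun setT (Y k)) -> (forall k, (0 <= r k)%R) ->
  (forall A B, measurable A -> measurable B ->
     P (H1 `&` (Z @^-1` A `&` X @^-1` B)) =
     \sum_(k < N) (r k)%:E * P (H2 `&` (Z @^-1` A `&` Y k @^-1` B))) ->
  forall C : set (S * V), measurable C ->
     P (H1 `&` [set w | C (Z w, X w)]) =
     \sum_(k < N) (r k)%:E * P (H2 `&` [set w | C (Z w, Y k w)]).
Proof.
move=> mH1 mH2 mX mY r0 HAB C mC.
pose ZX w := (Z w, X w); pose ZY k w := (Z w, Y k w).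
have mZX : measurable_fun setT ZX by exact: measurable_fun_pair.
have mZY k : measurable_fun setT (ZY k) by exact: measurable_fun_pair.
pose m1 : {measure set (S * V) -> \bar R} := pushforward (mrestr P mH1) ZX.
pose m2k k : {measure set (S * V) -> \bar R} :=
  mscale (NngNum (r0 k)) (pushforward (mrestr P mH2) (ZY k)).
pose m2 : {measure set (S * V) -> \bar R} := msum (m2k mZY) N.
have m1E D : m1 mZX D = P (H1 `&` [set w | D (Z w, X w)]).
  by rewrite /m1 /= /pushforward /mrestr setIC.
have m2E D : m2 D = \sum_(k < N) (r k)%:E * P (H2 `&` [set w | D (Z w, Y k w)]).
  rewrite /m2 /= /msum; apply: eq_bigr => k _.
  by rewrite /m2k /= /mscale /= /pushforward /mrestr setIC.
rewrite -m1E -m2E; apply: (@measure_eq_rectangles _ _ _ _ _ (m1 mZX) m2) => //.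
- rewrite m1E (@le_lt_trans _ _ 1)// ?ltry// probability_le1//.
  by apply: measurableI => //; exact: measurableT.
- by move=> A B mA mB; rewrite m1E m2E HAB.
Qed.

(** If, on [H], the variable [X] is independent of [Z] with law [Q], the law of
    [(Z, X)] on [H] is computed by sections. *)
Lemma pair_law_indep (H : set Omega) (X : Omega -> V) (Q : probability V R) :
  measurable H -> measurable_fun setT X ->
  (forall A B, measurable A -> measurable B ->
     P (H `&` (Z @^-1` A `&` X @^-1` B)) = P (H `&` Z @^-1` A) * Q B) ->
  forall C : set (S * V), measurable C ->
     P (H `&` [set w | C (Z w, X w)]) = \int[P]_(w in H) Q (xsection C (Z w)).
Proof.
move=> mH mX HAB C mC.
pose ZX w := (Z w, X w); pose ZV (p : Omega * V) := (Z p.1, p.2).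
have mZX : measurable_fun setT ZX by exact: measurable_fun_pair.
have mZV : measurable_fun setT ZV.
  by apply: measurable_fun_pair => //; exact: measurableT_comp.
have mHT : measurable (H `*` [set: V]) by exact: measurableX.
pose m1 : {measure set (S * V) -> \bar R} := pushforward (mrestr P mH) ZX.
pose m2 : {measure set (S * V) -> \bar R} :=
  pushforward (mrestr (P \x Q) mHT) ZV.
have m1E D : m1 mZX D = P (H `&` [set w | D (Z w, X w)]).
  by rewrite /m1 /= /pushforward /mrestr setIC.
have m2E D : m2 mZV D = (P \x Q) (ZV @^-1` D `&` H `*` setT).
  by rewrite /m2 /= /pushforward /mrestr.
rewrite -m1E (@measure_eq_rectangles _ _ _ _ _ (m1 mZX) (m2 mZV))//.
- rewrite m2E /product_measure1 [RHS]integral_mkcond; apply: eq_integral => w _.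
  rewrite patchE /=; case: ifPn => [wH|wH].
    congr (Q _); apply/seteqP; split => v; rewrite /xsection /= !inE /=.
      by move=> [].
    by move=> Dv; split => //; split => //; rewrite inE in wH.
  rewrite (_ : xsection _ _ = set0) ?measure0//; apply/seteqP; split => // v.
  by rewrite /xsection /= inE => -[_ [/= Hw _]]; move: wH; rewrite notin_setE.
- rewrite m1E (@le_lt_trans _ _ 1)// ?ltry// probability_le1//.
  by apply: measurableI => //; exact: measurableT.
- move=> A B mA mB; rewrite m1E m2E.
  rewrite (_ : [set w | (A `*` B) (Z w, X w)] = Z @^-1` A `&` X @^-1` B)//.
  rewrite HAB// (_ : _ `&` _ = (H `&` Z @^-1` A) `*` B).
    by rewrite product_measure1E//; apply: measurableI => //; exact: measurable_preimage.
  by apply/seteqP; split => -[w v] /=; tauto.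
Qed.

End PairLaws.

Lemma uniform_prob_itv (R : realType) (a b : R) : 0 <= a -> a <= b -> b <= 1 ->
  uniform_prob (@ltr01 R) `]a, b] = (b - a)%:E.
Proof.
move=> a0 ab b1; rewrite /uniform_prob integral_uniform_pdf.
rewrite setIidl; last first.
  move=> x; rewrite /= !in_itv/= => /andP[ax xb].
  by rewrite (le_trans xb b1) andbT (le_trans a0 (ltW ax)).
rewrite (eq_integral (cst 1%E)); last first.
  move=> x; rewrite inE /= in_itv/= => /andP[ax xb]; rewrite /uniform_pdf.
  by rewrite (le_trans a0 (ltW ax)) (le_trans xb b1) subr0 invr1.
rewrite integral_cst//= mul1e lebesgue_measure_itv/= lte_fin.
by case: ltgtP ab => // -> _; rewrite subrr.
Qed.

(** * Paths through the endpoints *)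

Section Paths.
Context d (Omega : measurableType d) (R : realType) (P : probability Omega R).
Context (n : nat) (u : 'I_n.+1 -> {RV P >-> R}).
Implicit Types (z : n.+1.-tuple R) (c : seq nat) (w : Omega).

(** The endpoint of index [k <= n] in the tuple [z] of all the endpoints. *)
Definition endpt z (k : nat) : R := tnth z (inord k).

(** The tuple of all the endpoints. *)
Definition utuple w : n.+1.-tuple R := [tuple u i w | i < n.+1].

Lemma endptE w k : endpt (utuple w) k = u (inord k) w.
Proof. by rewrite /endpt tnth_mktuple. Qed.

Lemma measurable_utuple : measurable_fun setT utuple.
Proof.
apply/measurable_fun_tnthP => i; rewrite (_ : _ \o _ = u i)//.
by apply/funext => w; rewrite /= tnth_mktuple.
Qed.

Lemma measurable_endpt k : measurable_fun setT (endpt^~ k).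
Proof. exact: measurable_tnth. Qed.

Lemma measurable_endptu k : measurable_fun setT (fun w => endpt (utuple w) k).
Proof. exact: measurableT_comp (measurable_endpt k) measurable_utuple. Qed.

Hypothesis u01 : forall w, u ord0 w = 0 /\ u ord_max w = 1.
Hypothesis u_incr : forall w (i j : 'I_n.+1), (i < j)%N -> u i w < u j w.

Lemma endpt0 w : endpt (utuple w) 0 = 0.
Proof.
rewrite endptE (_ : inord 0 = ord0); first by have [] := u01 w.
by apply/val_inj; rewrite /= inordK.
Qed.

Lemma endptn w : endpt (utuple w) n = 1.
Proof.
rewrite endptE (_ : inord n = ord_max); first by have [] := u01 w.
by apply/val_inj; rewrite /= inordK.
Qed.

Lemma endpt_ltr w i j : (i < j <= n)%N ->
  endpt (utuple w) i < endpt (utuple w) j.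
Proof.
by move=> /andP[ij jn]; rewrite !endptE; apply: u_incr; rewrite !inordK; lia.
Qed.

Lemma endpt_lt w i j : (i <= n)%N -> (j <= n)%N ->
  (endpt (utuple w) i < endpt (utuple w) j) = (i < j)%N.
Proof.
move=> iN jN; have [ij|ji|->] := ltngtP i j; last by rewrite ltxx.
  by rewrite endpt_ltr ?ij.
by apply/negbTE; rewrite -leNgt ltW// endpt_ltr ?ji.
Qed.

Lemma endpt_le w i j : (i <= n)%N -> (j <= n)%N ->
  (endpt (utuple w) i <= endpt (utuple w) j) = (i <= j)%N.
Proof. by move=> iN jN; rewrite leNgt endpt_lt// -leqNgt. Qed.

Lemma endpt_inj w i j : (i <= n)%N -> (j <= n)%N ->
  endpt (utuple w) i = endpt (utuple w) j -> i = j.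
Proof.
by move=> iN jN ij; apply/eqP;
rewrite eqn_leq -(endpt_le w iN jN) -(endpt_le w jN iN) ij lexx.
Qed.

Lemma n_gt0 : inhabited Omega -> (0 < n)%N.
Proof.
move=> [w]; rewrite lt0n; apply/eqP => n0; have := endpt0 w.
by rewrite -n0 endptn => /eqP; rewrite oner_eq0.
Qed.

(** The event that the chain [X] starts with the successive endpoints whose
    indices are the partial sums of [c]. *)
Definition visit (X : nat -> Omega -> R) c : set Omega :=
  [set w | forall r, (r <= size c)%N ->
             X r w = endpt (utuple w) (sumn (take r c))].

Lemma visit_rcons X c k : visit X (rcons c k) =
  visit X c `&` [set w | X (size c).+1 w = endpt (utuple w) (sumn c + k)].
Proof.
apply/seteqP; split => w /=.
  move=> H; split => [r rc|]; last first.
    by rewrite H ?size_rcons// take_oversize ?size_rcons// sumn_rcons.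
  by rewrite H ?size_rcons ?leqW// -cats1 takel_cat.
move=> [H HS] r; rewrite size_rcons leq_eqVlt => /orP[/eqP ->|]; last first.
  by rewrite ltnS => rc; rewrite H// -cats1 takel_cat.
by rewrite HS take_oversize ?size_rcons// sumn_rcons.
Qed.

Lemma visit_last X c w : visit X c w ->
  X (size c) w = endpt (utuple w) (sumn c).
Proof. by move=> /(_ _ (leqnn _)); rewrite take_size. Qed.

Lemma measurable_visit X c : (forall j, measurable_fun setT (X j)) ->
  measurable (visit X c).
Proof.
move=> mX; rewrite (_ : visit X c = \bigcap_(r in [set r | (r <= size c)%N])
    [set w | X r w == endpt (utuple w) (sumn (take r c))]); last first.
  by apply/seteqP; split => w H r rc; [apply/eqP; exact: H|apply/eqP; exact: (H r)].
apply: bigcap_measurable => [|r _]; first by exists 0%N.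
have := measurable_fun_eqr (mX r) (measurable_endptu (sumn (take r c))).
by move=> /(_ measurableT [set true] Logic.I); rewrite setTI.
Qed.

Section Kernel.
Variable q : n.+1.-tuple R -> nat -> nat -> R.

(** Probability, given the endpoints, of the steps [c] from the endpoint of
    index [i], when [q z i k] is the probability of a step from the endpoint of
    index [i] to the endpoint of index [i + k]. *)
Fixpoint path_prob z (i : nat) c : R :=
  if c is k :: c' then q z i k * path_prob z (i + k) c' else 1.

Lemma path_prob_rcons z i c k :
  path_prob z i (rcons c k) = path_prob z i c * q z (i + sumn c) k.
Proof.
by elim: c i => [|j c IH] i /=; rewrite ?addn0 ?mulr1 ?mul1r// IH addnA mulrA.
Qed.

Hypothesis mq : forall i k, measurable_fun setT (fun z => q z i k).
Hypothesis q0 : forall w i k, (0 < k)%N -> (i + k <= n)%N -> 0 <= q (utuple w) i k.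

Lemma measurable_path_prob i c : measurable_fun setT (fun z => path_prob z i c).
Proof.
elim: c i => [|k c IH] i /=; first exact: measurable_cst.
by apply: measurable_funM; [exact: mq|exact: IH].
Qed.

Lemma path_prob_ge0 w i c : 0%N \notin c -> (i + sumn c <= n)%N ->
  0 <= path_prob (utuple w) i c.
Proof.
elim: c i => [|k c IH] i /=; first by rewrite ler01.
rewrite in_cons negb_or => /andP[k0 c0] ikc; rewrite mulr_ge0//.
  by apply: q0; lia.
by apply: IH => //; lia.
Qed.

Variable X : nat -> Omega -> R.
Hypothesis mX : forall j, measurable_fun setT (X j).
Hypothesis X0 : forall w, X 0%N w = 0.
Hypothesis X_step : forall c k (A : set (n.+1.-tuple R)),
  0%N \notin c -> (0 < k)%N -> (sumn c + k <= n)%N -> measurable A ->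
  P (visit X (rcons c k) `&` utuple @^-1` A) =
  (\int[P]_(w in visit X c `&` utuple @^-1` A) (q (utuple w) (sumn c) k)%:E)%E.

Lemma visit_nil : visit X [::] = setT.
Proof.
by apply/seteqP; split => // w _ [|r]//= _; rewrite X0 endpt0.
Qed.

Lemma mul_indic_integral (A : set Omega) (f : Omega -> R) :
  (\int[P]_(w in A) (f w)%:E = \int[P]_w (\1_A w * f w)%:E)%E.
Proof.
rewrite [LHS]integral_mkcond; apply: eq_integral => w _.
by rewrite patchE indicE; case: ifPn; rewrite ?mul1r ?mul0r.
Qed.

Let path_integral c (g : n.+1.-tuple R -> R) :
  0%N \notin c -> (sumn c <= n)%N ->
  (forall A, measurable A -> P (visit X c `&` utuple @^-1` A) =
   \int[P]_(w in utuple @^-1` A) (path_prob (utuple w) 0 c)%:E)%E ->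
  measurable_fun setT g -> (forall z, 0 <= g z) ->
  (\int[P]_w (\1_(visit X c) w * g (utuple w))%:E =
   \int[P]_w (path_prob (utuple w) 0 c * g (utuple w))%:E)%E.
Proof.
move=> c0 cn PA mg g0; have mv := measurable_visit c mX.
apply: (eq_integral_given measurable_utuple (p := \1_(visit X c))
  (q := fun w => path_prob (utuple w) 0 c)) => //.
- exact: measurableT_comp (measurable_path_prob 0 c) measurable_utuple.
- by move=> w; apply: path_prob_ge0 => //; rewrite add0n.
- move=> A mA; rewrite -PA// integral_indic//.
  exact: (measurable_preimage measurable_utuple mA).
Qed.

(** Joint law of the endpoints and of a path of the chain: the steps are
    multiplied one after the other. *)
Lemma path_law c A : 0%N \notin c -> (sumn c <= n)%N -> measurable A ->
  (P (visit X c `&` utuple @^-1` A) =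
   \int[P]_(w in utuple @^-1` A) (path_prob (utuple w) 0 c)%:E)%E.
Proof.
elim/last_ind: c A => [|c k IH] A.
  by move=> _ _ mA; rewrite visit_nil setTI /= integral_cst ?mul1e//;
    exact: (measurable_preimage measurable_utuple mA).
rewrite mem_rcons in_cons negb_or sumn_rcons => /andP[k0 c0] ckn mA.
have {}k0 : (0 < k)%N by rewrite lt0n eq_sym.
have cn : (sumn c <= n)%N by lia.
rewrite X_step// mul_indic_integral.
pose g z := \1_A z * `|q z (sumn c) k|.
have mg : measurable_fun setT g.
  apply: measurable_funM; first exact: measurable_indic.
  by apply: measurableT_comp => //; exact: mq.
transitivity (\int[P]_w (\1_(visit X c) w * g (utuple w))%:E)%E.
  apply: eq_integral => w _; rewrite indicI /g mulrA ger0_norm//.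
  exact: q0.
have g0 z : 0 <= g z by rewrite /g mulr_ge0.
rewrite (path_integral c0 cn (fun B mB => IH B c0 cn mB) mg g0).
rewrite mul_indic_integral; apply: eq_integral => w _.
rewrite path_prob_rcons add0n /g ger0_norm ?q0//; congr EFin.
by rewrite mulrCA.
Qed.

Lemma path_law_integral c (g : n.+1.-tuple R -> R) :
  0%N \notin c -> (sumn c <= n)%N ->
  measurable_fun setT g -> (forall z, 0 <= g z) ->
  (\int[P]_w (\1_(visit X c) w * g (utuple w))%:E =
   \int[P]_w (path_prob (utuple w) 0 c * g (utuple w))%:E)%E.
Proof.
by move=> c0 cn mg g0; apply: path_integral => // A mA; exact: path_law.
Qed.

End Kernel.

(** ** The D-partition *)

Section D.
Variable U : nat -> {RV P >-> R}.
Hypothesis hU : uniform_inputs u U.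

Lemma endpoints_above_inf w V m : (0 < m <= n)%N ->
  endpt (utuple w) m.-1 < V <= endpt (utuple w) m ->
  inf [set t | V <= t /\ endpoints u w t] = endpt (utuple w) m.
Proof.
move=> /andP[m0 mn] /andP[mV Vm].
have um : endpoints u w (endpt (utuple w) m) by exists (inord m) => //; rewrite endptE.
apply/eqP; rewrite eq_le; apply/andP; split.
  apply: ge_inf => //; exists V => t [] //.
apply: lb_le_inf; first by exists (endpt (utuple w) m).
move=> t [Vt [i _ ui]]; have iN : (i <= n)%N by rewrite -ltnS.
have uiE : t = endpt (utuple w) i by rewrite endptE inord_val.
have := lt_le_trans mV Vt; rewrite uiE endpt_lt ?endpt_le//; last by lia.
by case: (m) m0.
Qed.

(** The infimum that defines the D-chain is the next endpoint when
    [0 < V <= 1], and 0 otherwise. *)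
Lemma endpoints_above_cases w V :
  (exists2 m, (0 < m <= n)%N & endpt (utuple w) m.-1 < V <= endpt (utuple w) m) \/
  inf [set t | V <= t /\ endpoints u w t] = 0 /\ ~~ (0 < V <= 1).
Proof.
have [V1|V1] := ltP 1 V.
  (* There is no endpoint above [V], and the infimum of the empty set is 0. *)
  right; rewrite andbF; split => //.
  rewrite (_ : [set t | _] = set0) ?inf0//.
  apply/seteqP; split => // t [Vt [i _ ui]].
  have := lt_le_trans V1 Vt; rewrite -ui -(inord_val i) -endptE -(endptn w).
  by have iN := ltn_ord i; rewrite endpt_lt ?inord_val; lia.
have [V0|V0] := leP V 0.
  right; split => //; apply/eqP; rewrite eq_le; apply/andP; split.
    apply: ge_inf; first by exists V => t [].
    by split => //; exists ord0 => //; have [] := u01 w.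
  apply: lb_le_inf.
    by exists 0; split => //; exists ord0 => //; have [] := u01 w.
  move=> t [_ [i _ <-]]; rewrite -(inord_val i) -endptE -(endpt0 w) endpt_le//.
  by rewrite -ltnS.
left; have exm : exists k, V <= endpt (utuple w) k by exists n; rewrite endptn.
case: (ex_minnP exm) => k Vk kmin.
have kn : (k <= n)%N by apply: kmin; rewrite endptn.
have k0 : (0 < k)%N.
  by rewrite lt0n; apply: contraTneq Vk => ->; rewrite endpt0 -ltNge.
exists k; rewrite ?k0// Vk andbT ltNge; apply/negP => /kmin; lia.
Qed.

Lemma endpoints_above_infP w V m : (0 < m <= n)%N ->
  inf [set t | V <= t /\ endpoints u w t] = endpt (utuple w) m <->
  endpt (utuple w) m.-1 < V <= endpt (utuple w) m.
Proof.
move=> /[dup] mn /andP[m0 mn']; split; last exact: endpoints_above_inf.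
have [[k kn Vk]|[-> _] E] := endpoints_above_cases w V.
  rewrite (endpoints_above_inf kn Vk) => /endpt_inj.
  by have /andP[_ kn'] := kn; move=> /(_ kn' mn') <-.
by move: (endpt_lt w (leq0n n) mn'); rewrite endpt0 -E ltxx m0.
Qed.

Lemma measurable_DV j : measurable_fun setT (DV u U j).
Proof.
elim: j => [|j IH]; first exact: measurable_cst.
pose V w := DV u U j w + U j w * (1 - DV u U j w).
have mV : measurable_fun setT V.
  apply: measurable_funD => //; apply: measurable_funM => //.
  exact: measurable_funB.
pose D m := [set w | (endpt (utuple w) m < V w) && (V w <= endpt (utuple w) m.+1)].
have mD m : measurable (D m).
  have mb : measurable_fun setT (fun w =>
      (endpt (utuple w) m < V w) && (V w <= endpt (utuple w) m.+1)).
    apply: measurable_and.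
      exact: measurable_fun_ltr (measurable_endptu m) mV.
    exact: measurable_fun_ler mV (measurable_endptu m.+1).
  by have := mb measurableT [set true] Logic.I; rewrite setTI.
rewrite (_ : DV u U j.+1 =
    fun w => \sum_(m < n) \1_(D m) w * endpt (utuple w) m.+1).
  apply: measurable_sum => m; apply: measurable_funM; last exact: measurable_endptu.
  exact: measurable_indic.
apply/funext => w; have inD m : (w \in D m) =
    (endpt (utuple w) m < V w) && (V w <= endpt (utuple w) m.+1).
  by apply/idP/idP; rewrite inE.
rewrite /= -/(V w);
have [[k /[dup] kn /andP[k0 kn'] Vk]|[-> Vn]] := endpoints_above_cases w (V w).
  rewrite (endpoints_above_inf kn Vk); have kn2 : (k.-1 < n)%N by lia.
  rewrite (bigD1 (Ordinal kn2))//= indicE inD prednK// Vk mul1r.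
  rewrite big1 ?addr0// => m; rewrite -val_eqE /= => mk; rewrite indicE inD.
  case: (boolP (_ && _)) => [Vm|]; rewrite ?mul0r//; move: mk.
  have /endpt_inj E : endpt (utuple w) m.+1 = endpt (utuple w) k.
    have Em := @endpoints_above_inf w (V w) m.+1 (ltn_ord m) Vm.
    by rewrite -Em (endpoints_above_inf kn Vk).
  by rewrite -E ?ltn_ord//= eqxx.
rewrite big1// => m _; rewrite indicE inD.
case: (boolP (_ && _)) => [|]; rewrite ?mul0r//.
move=> /andP[mV' Vm]; case/negP: Vn.
have mn := ltn_ord m; rewrite (le_lt_trans _ mV') -?(endpt0 w) ?endpt_le//; last by lia.
by rewrite (le_trans Vm)// -(endptn w) endpt_le.
Qed.

(** Given the endpoints, the set of values of the uniform variable that lead the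
    D-chain from the endpoint of index [i] to that of index [i + k]. *)
Definition D_step_set (i k : nat) : set (n.+1.-tuple R * R) :=
  [set p | endpt p.1 (i + k).-1 < endpt p.1 i + p.2 * (1 - endpt p.1 i)
             <= endpt p.1 (i + k)].

(** Probability that the D-chain moves from the endpoint of index [i] to that of
    index [i + k], given the tuple [z] of the endpoints. *)
Definition D_step_prob z (i k : nat) : R :=
  (endpt z (i + k) - endpt z (i + k).-1) / (1 - endpt z i).

Lemma measurable_D_step_set i k : measurable (D_step_set i k).
Proof.
pose V (p : n.+1.-tuple R * R) := endpt p.1 i + p.2 * (1 - endpt p.1 i).
have me j : measurable_fun setT (fun p : n.+1.-tuple R * R => endpt p.1 j).
  exact: (measurableT_comp (measurable_endpt j) measurable_fst).
have mV : measurable_fun setT V.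
  apply: measurable_funD => //; apply: measurable_funM => //.
  exact: measurable_funB.
have mb : measurable_fun setT (fun p => (endpt p.1 (i + k).-1 < V p) &&
    (V p <= endpt p.1 (i + k))).
  by apply: measurable_and; [exact: measurable_fun_ltr|exact: measurable_fun_ler].
have := mb measurableT [set true] Logic.I; by rewrite setTI.
Qed.

Lemma measurable_D_step_prob i k : measurable_fun setT (fun z => D_step_prob z i k).
Proof.
apply: measurable_funM.
  by apply: measurable_funB; exact: measurable_endpt.
apply: measurable_fun_inv; apply: measurable_funB => //; exact: measurable_endpt.
Qed.

Lemma D_step_prob_ge0 w i k : (0 < k)%N -> (i + k <= n)%N ->
  0 <= D_step_prob (utuple w) i k.
Proof.
move=> k0 ikn; rewrite divr_ge0// subr_ge0.
  by rewrite endpt_le//; lia.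
by rewrite -(endptn w) endpt_le//; lia.
Qed.

Lemma DV_step w j i k : (0 < k)%N -> (i + k <= n)%N ->
  DV u U j w = endpt (utuple w) i ->
  DV u U j.+1 w = endpt (utuple w) (i + k) <-> D_step_set i k (utuple w, U j w).
Proof.
rewrite /D_step_set/= => k0 ikn ->; apply: endpoints_above_infP; lia.
Qed.

Lemma visit_DV_rcons c k : 0%N \notin c -> (0 < k)%N -> (sumn c + k <= n)%N ->
  visit (DV u U) (rcons c k) = visit (DV u U) c `&`
    [set w | D_step_set (sumn c) k (utuple w, U (size c) w)].
Proof.
move=> c0 k0 ckn; rewrite visit_rcons; apply/seteqP; split => w [vw] /=.
  by move/(DV_step k0 ckn (visit_last vw)).
by move=> /(DV_step k0 ckn (visit_last vw)).
Qed.

Let prodP (J : seq nat) (B : nat -> set R) : (forall j, measurable (B j)) ->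
  (\prod_(j <- J) P (U j @^-1` B j) =
   (\prod_(j <- J) fine (P (U j @^-1` B j)))%:E)%E.
Proof.
move=> mB; elim: J => [|j J IH]; first by rewrite !big_nil.
rewrite !big_cons IH EFinM fineK// fin_num_measure//.
exact: measurable_preimage.
Qed.

(** The part of the D-chain that is determined by the endpoints and the first
    [size c] uniform variables is independent of the later uniform variables. *)
Lemma visit_DV_indep c J (B : nat -> set R) A :
  0%N \notin c -> (sumn c <= n)%N ->
  uniq J -> {in J, forall j, (size c <= j)%N} ->
  (forall j, measurable (B j)) -> measurable A ->
  (P (visit (DV u U) c `&` utuple @^-1` A `&`
      \big[setI/setT]_(j <- J) (U j @^-1` B j)) =
   P (visit (DV u U) c `&` utuple @^-1` A) *
     \prod_(j <- J) P (U j @^-1` B j))%E.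
Proof.
have [_ Uind uUind] := hU.
elim/last_ind: c J B A => [|c k IH] J B A.
  move=> _ _ uJ _ mB mA; rewrite visit_nil// setTI.
  by rewrite -Uind//; exact: uUind.
rewrite mem_rcons in_cons negb_or sumn_rcons => /andP[k0 c0] ckn uJ Jc mB mA.
have {}k0 : (0 < k)%N by rewrite lt0n eq_sym.
have cn : (sumn c <= n)%N by lia.
set m := size c.
have mJ : m \notin J.
  by apply/negP => /Jc; rewrite size_rcons ltnn.
pose G := \big[setI/setT]_(j <- J) (U j @^-1` B j).
have mG : measurable G.
  by apply: bigsetI_measurable => j _; exact: measurable_preimage.
pose r := \prod_(j <- J) fine (P (U j @^-1` B j)).
have r0 : 0 <= r by apply: prodr_ge0 => j _; rewrite fine_ge0.
have mv : measurable (visit (DV u U) c).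
  by apply: measurable_visit; exact: measurable_DV.
pose C : set (n.+1.-tuple R * R) := D_step_set (sumn c) k `&` [set p | A p.1].
have mC : measurable C.
  apply: measurableI; first exact: measurable_D_step_set.
  exact: measurable_preimage.
have vC : visit (DV u U) (rcons c k) `&` utuple @^-1` A =
    visit (DV u U) c `&` [set w | C (utuple w, U m w)].
  rewrite visit_DV_rcons// -setIA; congr (_ `&` _).
rewrite vC prodP// -/r -/G setIAC.
rewrite (@pair_law_mixture _ _ _ P _ _ utuple _ _ measurable_utuple
  (visit (DV u U) c `&` G) (visit (DV u U) c) (U m) 1%N (fun=> r) (fun=> U m)) //.
- by rewrite big_ord1 muleC.
- exact: measurableI.
move=> A' B' mA' mB'; rewrite big_ord1.
(* On a rectangle, the events on [U m] and on the later variables form a single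
   product, to which the induction hypothesis applies. *)
pose B1 j := if j == m then B' else B j.
have mB1 j : measurable (B1 j) by rewrite /B1; case: ifP.
have GE : \big[setI/setT]_(j <- m :: J) (U j @^-1` B1 j) = U m @^-1` B' `&` G.
  rewrite big_cons /B1 eqxx; congr (_ `&` _); apply: eq_big_seq => j jJ.
  by rewrite ifN//; apply: contraNneq mJ => <-.
have J1 : {in m :: J, forall j, (size c <= j)%N}.
  move=> j; rewrite inE => /orP[/eqP->//|/Jc]; rewrite size_rcons; exact: ltnW.
have uJ1 : uniq (m :: J) by rewrite /= mJ.
have := IH _ _ _ c0 cn uJ1 J1 mB1 mA'; rewrite GE.
have := IH [:: m] (fun=> B') A' c0 cn isT _ _ mA'; rewrite !big_seq1 => Im I1.
rewrite (_ : _ `&` _ = visit (DV u U) c `&` utuple @^-1` A' `&` (U m @^-1` B' `&` G)).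
  rewrite I1 setIA Im//; last by move=> j; rewrite inE => /eqP ->.
  rewrite big_cons /B1 eqxx [in RHS]muleC -muleA; congr (_ * _)%E.
  rewrite -prodP//; congr (_ * _)%E; apply: eq_big_seq => j jJ.
  by rewrite ifN//; apply: contraNneq mJ => <-.
by apply/seteqP; split => w /=; tauto.
Qed.

(** Given the endpoints and a path of the D-chain, the next step has the law
    [D_step_prob]. *)
Lemma DV_law_step c k (A : set (n.+1.-tuple R)) :
  0%N \notin c -> (0 < k)%N -> (sumn c + k <= n)%N -> measurable A ->
  P (visit (DV u U) (rcons c k) `&` utuple @^-1` A) =
  (\int[P]_(w in visit (DV u U) c `&` utuple @^-1` A)
     (D_step_prob (utuple w) (sumn c) k)%:E)%E.
Proof.
move=> c0 k0 ckn mA; have [Ulaw _ _] := hU.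
have cn : (sumn c <= n)%N by lia.
have mvA : measurable (visit (DV u U) c `&` utuple @^-1` A).
  apply: measurableI; first by apply: measurable_visit; exact: measurable_DV.
  exact: (measurable_preimage measurable_utuple mA).
rewrite visit_DV_rcons// setIAC.
rewrite (pair_law_indep measurable_utuple (X := U (size c))
    (Q := distribution P (U (size c))) mvA)//; last 2 first.
- move=> A' B' mA' mB'; rewrite /distribution /pushforward.
  have := @visit_DV_indep c [:: size c] (fun=> B') (A `&` A') c0 cn isT.
  rewrite !big_seq1 preimage_setI setIA => <-//; first by rewrite !setIA.
  + by move=> j; rewrite inE => /eqP ->.
  + exact: measurableI.
- exact: measurable_D_step_set.
apply: eq_integral => w _.
have e1 : 0 < 1 - endpt (utuple w) (sumn c).
  by rewrite subr_gt0 -(endptn w) endpt_lt//; lia.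
rewrite (_ : xsection _ _ =
  `](endpt (utuple w) (sumn c + k).-1 - endpt (utuple w) (sumn c)) /
    (1 - endpt (utuple w) (sumn c)),
    (endpt (utuple w) (sumn c + k) - endpt (utuple w) (sumn c)) /
    (1 - endpt (utuple w) (sumn c))]%classic); last first.
  apply/seteqP; split => v; rewrite /xsection /D_step_set/= inE /= in_itv/=;
    by rewrite ltr_pdivrMr// ler_pdivlMr// ltrBlDl lerBrDl.
rewrite -[LHS]/(distribution P (U (size c)) _) Ulaw ?uniform_prob_itv//.
- by rewrite /D_step_prob -mulrBl opprB addrA subrK.
- by rewrite divr_ge0 ?(ltW e1)// subr_ge0 endpt_le; lia.
- by rewrite ler_pM2r ?invr_gt0// lerB// endpt_le; lia.
- by rewrite ler_pdivrMr// mul1r lerB// -(endptn w) endpt_le; lia.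
Qed.

End D.

End Paths.

(** ** The T-partition *)

Section TPaths.
Context d (Omega : measurableType d) (R : realType) (P : probability Omega R).
Context (n : nat) (u : 'I_n.+1 -> {RV P >-> R}).
Hypothesis u01 : forall w, u ord0 w = 0 /\ u ord_max w = 1.
Hypothesis u_incr : forall w (i j : 'I_n.+1), (i < j)%N -> u i w < u j w.
Local Notation utuple := (utuple u).

Lemma uniform_above_endpt w i (B : set R) : (i <= n)%N ->
  uniform_above u w (endpt (utuple w) i) B =
  \sum_(k < n - i) (n - i)%:R^-1 * \1_B (endpt (utuple w) (i + k.+1)).
Proof.
move=> iN; rewrite -mulr_sumr mulrC.
have cardE (Q : pred 'I_n.+1) : #|[set j : 'I_n.+1 |
      (endpt (utuple w) i < u j w) && Q j]%SET| =
    (\sum_(k < n - i) Q (inord (i + k.+1)))%N.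
  rewrite -sum1dep_card big_mkcond/=.
  transitivity (\sum_(j < n.+1) ((i < j)%N && Q (inord j)))%N.
    apply: eq_bigr => j _; rewrite inord_val -{1}(inord_val j) -endptE.
    by rewrite endpt_lt// -1?ltnS//; case: (_ && _).
  rewrite -(big_mkord xpredT (fun j => nat_of_bool ((i < j)%N && Q (inord j)))).
  rewrite (@big_cat_nat _ _ _ i.+1)//=.
  rewrite big_nat big1 ?add0n => [|j /= ji]; last by rewrite ltnNge -ltnS ji.
  rewrite -{1}(add0n i.+1) big_addn subSS big_mkord; apply: eq_bigr => k _.
  by rewrite leq_addl addnS addnC -addnS.
rewrite /uniform_above; congr (_ / _).
  rewrite (cardE (fun j => u j w \in B)) natr_sum; apply: eq_bigr => k _.
  by rewrite endptE indicE.
rewrite (_ : [set _ | _]%SET = [set j : 'I_n.+1 |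
  (endpt (utuple w) i < u j w) && xpredT j]%SET); last first.
  by apply/setP => j; rewrite !inE andbT.
by rewrite cardE sum1_card card_ord.
Qed.

(** Probability that the T-chain moves from the endpoint of index [i] to that of
    index [i + k]; it depends neither on [k] nor on the endpoints. *)
Definition T_step_prob (z : n.+1.-tuple R) (i k : nat) : R := (n - i)%:R^-1.

Variable T : nat -> {RV P >-> R}.
Hypothesis hT : T_chain u T.

(** Given the endpoints and a path of the T-chain, the next step is uniform on
    the remaining endpoints. *)
Lemma T_law_step (c : seq nat) k (A : set (n.+1.-tuple R)) :
  0%N \notin c -> (0 < k)%N -> (sumn c + k <= n)%N -> measurable A ->
  P (visit u T (rcons c k) `&` utuple @^-1` A) =
  (\int[P]_(w in visit u T c `&` utuple @^-1` A)
     (T_step_prob (utuple w) (sumn c) k)%:E)%E.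
Proof.
move=> c0 k0 ckn mA; have [_ Tchain] := hT.
have cn : (sumn c <= n)%N by lia.
set i := sumn c; set m := size c.
have mT j : measurable_fun setT (T j : Omega -> R) by [].
have mu := measurable_utuple u.
have mv : measurable (visit u T c) by exact: measurable_visit.
have mvA : measurable (visit u T c `&` utuple @^-1` A).
  by apply: measurableI => //; exact: measurable_preimage mu mA.
pose r : R := (n - i)%:R^-1.
have r0 : 0 <= r by rewrite invr_ge0.
pose Y j w := endpt (utuple w) (i + j.+1).
have mY j : measurable_fun setT (Y j) by exact: measurable_endptu.
pose C : set (n.+1.-tuple R * R) := [set p | A p.1 /\ p.2 = endpt p.1 (i + k)].
have mC : measurable C.
  apply: measurableI; first exact: (measurable_preimage measurable_fst mA).
  have := measurable_fun_eqr
    (measurable_snd : measurable_fun setT (snd : n.+1.-tuple R * R -> R))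
    (measurableT_comp (measurable_endpt (i + k)) measurable_fst).
  move=> /(_ measurableT [set true] Logic.I); rewrite setTI; congr measurable.
  by apply/seteqP; split => p /=; move/eqP.
rewrite visit_rcons setIAC -setIA.
rewrite (_ : _ `&` [set w | _] = [set w | C (utuple w, T m.+1 w)])//.
(* On the path [c], the next point is a mixture, with equal weights [r], of the
   endpoints [Y j] to the right of the endpoint of index [i]. *)
rewrite (@pair_law_mixture _ _ _ P _ _ utuple _ _ mu
  (visit u T c) (visit u T c) (T m.+1) (n - i) (fun=> r) Y)//; last first.
  move=> A' B mA' mB.
  pose C' : set (n.+1.-tuple R * m.+1.-tuple R) := [set p | A' p.1] `&`
    \bigcap_(s in [set: 'I_m.+1])
      [set p | tnth p.2 s == endpt p.1 (sumn (take s c))].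
  have mC' : measurable C'.
    apply: measurableI; first exact: (measurable_preimage measurable_fst mA').
    apply: fin_bigcap_measurable => // s _.
    pose p1 (p : n.+1.-tuple R * m.+1.-tuple R) := tnth p.2 s.
    pose p2 (p : n.+1.-tuple R * m.+1.-tuple R) := endpt p.1 (sumn (take s c)).
    have mp1 : measurable_fun setT p1.
      exact: (measurableT_comp (measurable_tnth s) measurable_snd).
    have mp2 : measurable_fun setT p2.
      exact: (measurableT_comp (measurable_endpt _) measurable_fst).
    have := measurable_fun_eqr mp1 mp2.
    by move=> /(_ measurableT [set true] Logic.I); rewrite setTI.
  have EE : [set w | C' ([tuple u i w | i < n.+1], [tuple T i w | i < m.+1]) /\
      forall i, (i <= m)%N -> T i w < 1] = visit u T c `&` utuple @^-1` A'.
    apply/seteqP; split => [w [[/= A'w Cw] _]|w [vw A'w]].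
      split => // s sc; have := Cw (Ordinal (sc : (s < m.+1)%N)) Logic.I.
      by rewrite /= tnth_mktuple => /eqP.
    split; first split => // s _ /=.
      by rewrite tnth_mktuple; apply/eqP/vw; rewrite -ltnS.
    move=> s sm; rewrite (vw s sm) -(endptn u01 w) endpt_lt//; last first.
      rewrite (leq_trans _ cn)// -{2}(cat_take_drop s c) sumn_cat leq_addr//.
    rewrite (leq_ltn_trans _ (_ : i < n)%N)//; last by rewrite /i; lia.
    by rewrite /i -{2}(cat_take_drop s c) sumn_cat leq_addr.
  have := Tchain m C' B mC' mB; rewrite /= EE -setIA => ->.
  have mvA' : measurable (visit u T c `&` utuple @^-1` A').
    by apply: measurableI => //; exact: measurable_preimage mu mA'.
  transitivity (\int[P]_(w in visit u T c `&` utuple @^-1` A')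
      \sum_(j < n - i) r%:E * (\1_(Y j @^-1` B) w)%:E)%E.
    apply: eq_integral => w; rewrite inE => -[vw _].
    rewrite (visit_last vw) uniform_above_endpt// -sumEFin.
    by apply: eq_bigr => j _; rewrite EFinM.
  have mYB j : measurable (Y j @^-1` B) by exact: measurable_preimage.
  rewrite ge0_integral_sum//.
  - apply: eq_bigr => j _; rewrite ge0_integralZl//.
    + by rewrite integral_indic// setIC setIA.
    + by apply/measurable_EFinP; exact: measurable_indic.
  - move=> j; apply: measurable_funeM; apply/measurable_EFinP.
    exact: measurable_indic.
  - by move=> j w _; rewrite mule_ge0 ?lee_fin.
have kn : (k.-1 < n - i)%N by lia.
rewrite (bigD1 (Ordinal kn))//= big1 ?adde0.
  rewrite /T_step_prob integral_cst//; congr (_ * P _)%E.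
  by apply/seteqP; split => w [vw] /=; [case|rewrite /Y prednK].
move=> j; rewrite -val_eqE/= => jk.
rewrite (_ : [set w | _] = set0) ?setI0 ?measure0 ?mule0//.
apply/seteqP; split => // w [_ /= /endpt_inj E].
have jn := ltn_ord j; move: E => /(_ u_incr); lia.
Qed.

End TPaths.

(** * Exchangeability *)

Section Exchangeability.
Context d (Omega : measurableType d) (R : realType) (P : probability Omega R).
Context (n : nat) (u : 'I_n.+1 -> {RV P >-> R}).
Hypothesis hu : exchangeable_partition u.

(** The lengths of the [n] intervals, from left to right. *)
Definition ltuple (w : Omega) : n.-tuple R := [tuple len u i w | i < n].

(** The lengths of the [n] intervals in decreasing order. *)
Definition ytuple (w : Omega) : n.-tuple R :=
  [tuple nth 0 (longest_lengths u n w) i | i < n].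

(** The event that the interval number [i] has rank [s i], for all [i]. *)
Definition rank_event (s : 'S_n) : set Omega :=
  [set w | longest_order u n w = perm_word s].

Lemma measurable_len i : measurable_fun setT (len u i).
Proof. by apply: measurable_funB. Qed.

Lemma len_gt0 i w : 0 < len u i w.
Proof.
have [_ uinc _ _] := hu; rewrite subr_gt0; apply: uinc => /=.
by rewrite /bump.
Qed.

Lemma len_rank_lt i w : (len_rank u i w < n)%N.
Proof.
rewrite /len_rank -[X in (_ < X)%N]card_ord -cardsT proper_card//.
rewrite properE finset.subsetT /=; apply/subsetPn; exists i; rewrite ?inE// ltxx//.
Qed.

Lemma rank_eventE s : rank_event s = [set w | forall i, len_rank u i w = s i].
Proof.
apply/seteqP; split => w /=; rewrite /rank_event /longest_order /perm_word /=.
  rewrite (_ : [seq r <- _ | _] = [seq len_rank u i w | i <- enum 'I_n]).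
    by move=> /eq_in_map H i; apply: H; rewrite mem_enum.
  by apply/all_filterP/allP => r /mapP[i _ ->]; exact: len_rank_lt.
move=> H; rewrite (_ : [seq r <- _ | _] = [seq len_rank u i w | i <- enum 'I_n]).
  by apply/eq_in_map => i _.
by apply/all_filterP/allP => r /mapP[i _ ->]; exact: len_rank_lt.
Qed.

Lemma measurable_rank_event s : measurable (rank_event s).
Proof.
have mD i j : measurable_fun setT (fun w => len u i w < len u j w).
  by apply: measurable_fun_ltr; exact: measurable_len.
rewrite rank_eventE (_ : [set w | _] = \bigcap_(i in [set: 'I_n])
   [set w | len_rank u i w == s i :> nat]).
  apply: fin_bigcap_measurable => // i _.
  have mr : measurable_fun setT (len_rank u i : Omega -> nat).
    by apply: measurable_card => j; exact: mD.
  have := mr measurableT [set nat_of_ord (s i)] Logic.I; rewrite setTI.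
  by congr measurable; apply/seteqP; split => w /eqP.
by apply/seteqP; split => w /= H i; [move=> _; apply/eqP|apply/eqP/H].
Qed.

Lemma longest_lengths_perm w :
  perm_eq (longest_lengths u n w) [seq len u i w | i <- enum 'I_n].
Proof.
by rewrite /longest_lengths take_oversize ?perm_sort// size_sort size_map size_enum_ord.
Qed.

Lemma size_longest_lengths w : size (longest_lengths u n w) = n.
Proof. by rewrite (perm_size (longest_lengths_perm w)) size_map size_enum_ord. Qed.

Lemma val_ytuple w : ytuple w = longest_lengths u n w :> seq R.
Proof.
apply: (@eq_from_nth _ 0) => [|i]; rewrite size_tuple ?size_longest_lengths// => iN.
by rewrite -[i]/(nat_of_ord (Ordinal iN)) -tnth_nth tnth_mktuple.
Qed.

Lemma ytuple_gt0 w i : 0 < tnth (ytuple w) i.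
Proof.
have : tnth (ytuple w) i \in (ytuple w : seq R) by exact: mem_tnth.
rewrite val_ytuple (perm_mem (longest_lengths_perm w)) => /mapP[j _ ->].
exact: len_gt0.
Qed.

(** On [rank_event s], reading the lengths along the inverse of [s] sorts them. *)
Lemma rank_event_len s w i : rank_event s w -> len u i w = tnth (ytuple w) (s i).
Proof.
rewrite rank_eventE => /= H.
pose L := [seq len u j w | j <- enum 'I_n].
pose Y := [seq len u ((s^-1)%g k) w | k <- enum 'I_n].
have szY : size Y = n by rewrite size_map size_enum_ord.
have nthY (k : 'I_n) : nth 0 Y k = len u ((s^-1)%g k) w.
  by rewrite (nth_map k) ?size_enum_ord// nth_ord_enum.
have pY : perm_eq Y L.
  rewrite /Y (map_comp (fun j => len u j w)); apply: perm_map.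
  apply: uniq_perm; last 1 first.
  - move=> k; rewrite mem_enum; apply/mapP; exists (s k); rewrite ?mem_enum//.
    by rewrite permK.
  - by rewrite (map_inj_uniq (@perm_inj _ (s^-1)%g)) enum_uniq.
  - exact: enum_uniq.
have sY : sorted >=%O Y.
  apply/(sortedP 0) => k; rewrite szY => kn.
  have kn' : (k < n)%N by lia.
  rewrite -[k]/(nat_of_ord (Ordinal kn')) nthY.
  rewrite -[k.+1]/(nat_of_ord (Ordinal kn)) nthY /= leNgt; apply/negP => lt.
  have : (len_rank u ((s^-1)%g (Ordinal kn)) w <=
          len_rank u ((s^-1)%g (Ordinal kn')) w)%N.
    apply/subset_leq_card/fintype.subsetP => j; rewrite !inE.
    exact: lt_trans.
  by rewrite !H !permKV /= ltnn.
have YE : longest_lengths u n w = Y.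
  rewrite /longest_lengths take_oversize; last first.
    by rewrite size_sort size_map size_enum_ord.
  apply: (sorted_eq (leT := >=%O)) => //; first exact: ge_trans.
  - exact: ge_anti.
  - by apply: sort_sorted => x y; exact: le_total.
  - by rewrite perm_sort perm_sym.
by rewrite (tnth_nth 0) val_ytuple YE nthY permK.
Qed.

Lemma measurable_ltuple : measurable_fun setT ltuple.
Proof.
apply/measurable_fun_tnthP => i; rewrite (_ : _ \o _ = len u i).
  exact: measurable_len.
by apply/funext => w; rewrite /= tnth_mktuple.
Qed.

Lemma measurable_ytuple : measurable_fun setT ytuple.
Proof.
have mge : measurable_fun setT (fun p : R * R => p.1 >= p.2).
  exact: (measurable_fun_ler measurable_snd measurable_fst).
have random : seq_random (longest_lengths u n).
  move=> A mA; rewrite (_ : _ @^-1` _ =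
      [set w | [set z | A (sort >=%O z)] [seq len u i w | i <- enum 'I_n]]).
    apply: measurable_seq_map; first exact: measurable_len.
    apply: (seq_measurable_sort mge) => //.
    - by move=> x y; exact: le_total.
    - exact: ge_trans.
    - exact: ge_anti.
  apply/seteqP; split => w; rewrite /= /longest_lengths take_oversize//;
    by rewrite size_sort size_map size_enum_ord.
apply/measurable_fun_tnthP => i.
rewrite (_ : _ \o _ = fun w => nth 0 (longest_lengths u n w) i); last first.
  by apply/funext => w /=; rewrite tnth_mktuple.
have mnth : seq_mfun (fun z : seq R => nth 0 z i) by move=> m; exact: measurable_nth.
exact: measurable_seq_mfun mnth random.
Qed.

(** The order of the intervals is uniform and independent of their decreasing
    lengths; for [n = 1] there is only one order. *)
Lemma rank_event_law s A : measurable A ->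
  (P (rank_event s `&` ytuple @^-1` A) =
   (n`!%:R^-1)%:E * P (ytuple @^-1` A))%E.
Proof.
move=> mA; have [u01 _ _ hex] := hu.
have [n2|n1] := leqP 2 n.
  have n2n : (2 <= n <= n)%N by rewrite n2 leqnn.
  have [PE Pind] := hex n n2n s.
  rewrite -PE -/(rank_event s).
  pose A' := [set z : seq R | A [tuple nth 0 z i | i < n]].
  have mA' : seq_measurable A'.
    move=> m; rewrite -[X in measurable X]setTI.
    have : measurable_fun setT (fun t : m.-tuple R => [tuple nth 0 t i | i < n]).
      apply/measurable_fun_tnthP => i.
      rewrite (_ : _ \o _ = fun t : m.-tuple R => nth 0 t i); last first.
        by apply/funext => t /=; rewrite tnth_mktuple.
      exact: measurable_nth.
    by move=> /(_ measurableT A mA).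
  exact: (Pind A' mA').
rewrite (_ : rank_event s = setT) ?setTI.
  by rewrite (_ : n`! = 1%N) ?invr1 ?mul1e//; case: (n) n1 => [|[]].
apply/seteqP; split => // w _; rewrite rank_eventE => i /=.
have := len_rank_lt i w; have := ltn_ord (s i); lia.
Qed.

Lemma rank_event_prob s : P (rank_event s) = (n`!%:R^-1)%:E.
Proof.
by have := rank_event_law s measurableT;
  rewrite preimage_setT setIT probability_setT mule1.
Qed.

Lemma rank_event_trivIset : trivIset setT rank_event.
Proof.
apply/trivIsetP => s s' _ _ ss'; apply/seteqP; split => // w [].
rewrite !rank_eventE /= => H H'; move/eqP: ss'; apply.
by apply/permP => i; apply/val_inj; rewrite /= -H H'.
Qed.

(** The sequence of the lengths is the decreasing sequence of the lengths,
    uniformly permuted. *)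
Lemma exchangeable_integral (g : n.-tuple R -> R) :
  measurable_fun setT g -> (forall t, (forall i, 0 < tnth t i) -> 0 <= g t) ->
  (\int[P]_w (g (ltuple w))%:E =
   \int[P]_w (n`!%:R^-1 *
     \sum_(s : 'S_n) g [tuple tnth (ytuple w) (s i) | i < n])%:E)%E.
Proof.
move=> mg g0; have fact0 : 0 <= (n`!%:R^-1 : R) by rewrite invr_ge0.
pose yperm (s : 'S_n) (t : n.-tuple R) := [tuple tnth t (s i) | i < n].
have myp s : measurable_fun setT (yperm s).
  apply/measurable_fun_tnthP => i.
  rewrite (_ : _ \o _ = @tnth n R ^~ (s i)); first exact: measurable_tnth.
  by apply/funext => t /=; rewrite tnth_mktuple.
have gyp w s : 0 <= g (yperm s (ytuple w)).
  by apply: g0 => i; rewrite tnth_mktuple ytuple_gt0.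
have mgyp s : measurable_fun setT (fun w => g (yperm s (ytuple w))).
  exact: (measurableT_comp (measurableT_comp mg (myp s)) measurable_ytuple).
rewrite (@integral_cover _ _ _ P _ (enum 'S_n) rank_event).
- transitivity (\sum_(s : 'S_n) \int[P]_w (n`!%:R^-1 * g (yperm s (ytuple w)))%:E)%E.
    rewrite big_enum/=; apply: eq_bigr => s _.
    transitivity (\int[P]_w (\1_(rank_event s) w * g (yperm s (ytuple w)))%:E)%E.
      apply: eq_integral => w _; rewrite indicE; case: (boolP (w \in _)).
        rewrite inE => ws; rewrite !mul1r; congr (g _)%:E.
        apply: eq_from_tnth => i; rewrite [LHS]tnth_mktuple [RHS]tnth_mktuple.
        exact: rank_event_len.
      by rewrite !mul0r.
    apply: (@eq_integral_given _ _ _ P _ _ _ measurable_ytuple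
      (\1_(rank_event s)) (fun=> n`!%:R^-1) (g \o yperm s)) => //.
    + exact: measurable_indic (measurable_rank_event s).
    + move=> A mA; have mYA := measurable_preimage measurable_ytuple mA.
      rewrite integral_indic//; last exact: measurable_rank_event.
      by apply: (etrans (rank_event_law s mA)); rewrite integral_cst.
    + exact: measurableT_comp.
    + by move=> w; exact: gyp.
  rewrite -ge0_integral_sum//.
  + by apply: eq_integral => w _; rewrite mulr_sumr sumEFin.
  + by move=> s; apply/measurable_EFinP; exact: measurable_funM.
  + by move=> s w _; rewrite lee_fin mulr_ge0.
- exact: measurable_rank_event.
- exact: enum_uniq.
- by apply: sub_trivIset rank_event_trivIset.
- rewrite big_enum/= (eq_bigr (fun=> (n`!%:R^-1)%:E)) => [|s _];
    last exact: rank_event_prob.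
  rewrite sumEFin sumr_const; congr EFin; rewrite -[LHS]mulr_natr.
  by rewrite (_ : #|_| = n`!) ?mulVf ?pnatr_eq0 -?lt0n ?fact_gt0// card_Sn.
- exact: (measurableT_comp mg measurable_ltuple).
- by move=> w; apply: g0 => i; rewrite tnth_mktuple len_gt0.
Qed.

End Exchangeability.

(** * From paths to blocks *)

Lemma first_hit1E (R : realType) (x : nat -> R) m :
  x m = 1 -> (forall i, (i < m)%N -> x i <> 1) -> first_hit1 x = m.
Proof.
move=> xm xi; apply: xget_unique => // k [xk xki].
have [km|mk|//] := ltngtP k m; first by have := xi _ km xk.
by have := xki _ mk xm.
Qed.

Section Coordinates.
Context d (Omega : measurableType d) (R : realType) (P : probability Omega R).
Context (n : nat) (u : 'I_n.+1 -> {RV P >-> R}).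
Hypothesis hu : exchangeable_partition u.

Let u01 w : u ord0 w = 0 /\ u ord_max w = 1.
Proof. by have [] := hu. Qed.

Let u_incr w (i j : 'I_n.+1) : (i < j)%N -> u i w < u j w.
Proof. by have [_ + _ _] := hu; apply. Qed.

Local Notation utuple := (utuple u).
Local Notation y w := (tnth (ltuple u w)).

Lemma left_endE (i : 'I_n) w : left_end u i w = endpt (utuple w) i.
Proof.
by rewrite endptE /left_end; congr (u _ w); apply/val_inj; rewrite /= inordK// ltnW// ltnS.
Qed.

Lemma right_endE (i : 'I_n) w : right_end u i w = endpt (utuple w) i.+1.
Proof.
rewrite endptE /right_end; congr (u _ w); apply/val_inj.
by rewrite /= inordK// ltnS.
Qed.

Lemma yE (i : 'I_n) w : y w i = endpt (utuple w) i.+1 - endpt (utuple w) i.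
Proof. by rewrite tnth_mktuple /len left_endE right_endE. Qed.

Lemma mass_interval w i k : (i + k <= n)%N ->
  mass (y w) (take k (drop i (enum 'I_n))) =
  endpt (utuple w) (i + k) - endpt (utuple w) i.
Proof.
move=> ikn; rewrite /mass (eq_bigr (fun j : 'I_n =>
    endpt (utuple w) j.+1 - endpt (utuple w) j)); last by move=> j _; rewrite yE.
rewrite -(big_map val xpredT (fun j => endpt (utuple w) j.+1 - endpt (utuple w) j)).
rewrite map_take map_drop val_enum_ord drop_iota take_iota add0n.
rewrite (_ : iota _ _ = index_iota i (i + k)); last by congr iota; lia.
by rewrite telescope_sumr// leq_addr.
Qed.

Lemma last_mass_interval w i k : (0 < k)%N -> (i + k <= n)%N ->
  last_mass (y w) (take k (drop i (enum 'I_n))) =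
  endpt (utuple w) (i + k) - endpt (utuple w) (i + k).-1.
Proof.
case: k => // k _ ikn; have ikn' : (i + k < n)%N by lia.
rewrite /last_mass map_take map_drop (take_nth 0); last first.
  by rewrite size_drop size_map size_enum_ord; lia.
rewrite last_rcons nth_drop (nth_map (Ordinal ikn')) ?size_enum_ord//.
rewrite -[X in nth _ _ X]/(nat_of_ord (Ordinal ikn')) nth_ord_enum yE /=.
by rewrite !addnS.
Qed.

Lemma path_prob_D w i c : 0%N \notin c -> (i + sumn c)%N = n ->
  path_prob (@D_step_prob R n) (utuple w) i c =
  pathD (y w) (reshape c (drop i (enum 'I_n))).
Proof.
elim: c i => [|k c IH] i /=; first by rewrite /pathD/= big_nil mulr1.
rewrite in_cons negb_or => /andP[k0 c0] ikc; rewrite IH//; last by rewrite -addnA.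
rewrite /pathD /= drop_drop !big_cons [LHS]mulrCA !mulrA -[in RHS]mulrA.
rewrite last_mass_interval; [|lia|lia].
rewrite (_ : mass _ _ + _ = 1 - endpt (utuple w) i).
  by rewrite /D_step_prob addnC; ring.
rewrite big_map -mass_flatten reshapeKr ?size_drop ?size_enum_ord; last by lia.
rewrite -(endptn u01 w) -(take_size (drop (k + i) _)) size_drop size_enum_ord.
rewrite !mass_interval; [|lia|lia].
rewrite (_ : (k + i + (n - (k + i)))%N = n); last by lia.
by rewrite (addnC k i); ring.
Qed.

Lemma path_prob_T w i c : 0%N \notin c -> (i + sumn c)%N = n ->
  path_prob (@T_step_prob R n) (utuple w) i c = inv_tails [seq k%:R | k <- c].
Proof.
elim: c i => [|k c IH] i //=; rewrite in_cons negb_or => /andP[k0 c0] ikc.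
rewrite IH//; last by rewrite -addnA.
rewrite /T_step_prob big_cons big_map; congr (_^-1 * _).
have -> : \sum_(j <- c) j%:R = (sumn c)%:R :> R by rewrite sumnE natr_sum.
by rewrite -natrD; congr (_%:R); lia.
Qed.

Lemma num_inside_endpt w a b : (a <= b <= n)%N ->
  num_inside u (endpt (utuple w) a) (endpt (utuple w) b) w = (b - a)%N.
Proof.
move=> /andP[ab bn]; rewrite /num_inside.
rewrite (_ : [set _ | _]%SET = [set i : 'I_n | (a <= i < b)%N]%SET); last first.
  apply/setP => i; have iN := ltn_ord i; rewrite !inE left_endE right_endE.
  by rewrite !endpt_le//; lia.
rewrite -sum1dep_card -(big_mkord (fun i => (a <= i < b)%N) (fun=> 1%N)).
rewrite (@big_cat_nat _ _ _ a)//=; last by lia.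
rewrite (@big_cat_nat _ _ _ b a n)//=.
rewrite big_nat_cond big_pred0 => [|i]; last by lia.
rewrite big_nat_cond (eq_bigl (fun i => (a <= i < b)%N)) => [|i]; last by lia.
rewrite -big_nat sum_nat_const_nat muln1.
rewrite big_nat_cond big_pred0 => [|i]; last by lia.
by rewrite add0n addn0.
Qed.

(** On the event that the chain follows the composition [c] of [n], its
    bivariate sequence is read off the blocks of lengths [c]. *)
Lemma bivariate_visit (X : nat -> Omega -> R) c w :
  c \in compositions n -> visit u X c w ->
  bivariate u X w = blocks (y w) (reshape c (enum 'I_n)).
Proof.
rewrite mem_compositions => /andP[c0 /eqP cn] vw.
have cle r : (sumn (take r c) <= n)%N.
  by rewrite -cn -{2}(cat_take_drop r c) sumn_cat leq_addr.
have hit : first_hit1 (X^~ w) = size c.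
  apply: first_hit1E => [|r rc]; first by rewrite (visit_last vw) cn (endptn u01).
  rewrite (vw _ (ltnW rc)) -(endptn u01 w) => /endpt_inj E.
  have := E u_incr (cle r) (leqnn n); rewrite -{1}cn -{2}(cat_take_drop r c) sumn_cat.
  rewrite (drop_nth 0%N rc) /= => Er.
  have : nth 0%N c r \in c by exact: mem_nth.
  by rewrite (_ : nth 0%N c r = 0%N) ?(negbTE c0)//; lia.
rewrite /bivariate hit; apply: (@eq_from_nth _ (0, 0%N)).
  by rewrite !size_map size_iota size_reshape.
rewrite size_map size_iota => r rc.
rewrite (nth_map 0%N) ?size_iota// (nth_map [::]) ?size_reshape// nth_iota// add0n.
have E : sumn (take r.+1 c) = (sumn (take r c) + nth 0%N c r)%N.
  by rewrite (take_nth 0%N rc) sumn_rcons.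
have le : (sumn (take r c) + nth 0 c r <= n)%N by rewrite -E.
rewrite nth_reshape mass_interval// vw// (vw _ (ltnW rc)) E; congr pair.
rewrite num_inside_endpt ?leq_addr// addKn size_takel// size_drop size_enum_ord.
by rewrite leq_subRL// cle.
Qed.

End Coordinates.

(** * The law of the bivariate sequences *)

Section BivariateMeasurability.
Context d (Omega : measurableType d) (R : realType) (P : probability Omega R).
Context (n : nat) (u : 'I_n.+1 -> {RV P >-> R}).
Variable X : nat -> Omega -> R.
Hypothesis mX : forall j, measurable_fun setT (X j).

Let measurable_bool (b : Omega -> bool) :
  measurable_fun setT b -> measurable [set w | b w].
Proof. by move=> /(_ measurableT [set true] Logic.I); rewrite setTI. Qed.

Lemma measurable_num_inside (a b : Omega -> R) :
  measurable_fun setT a -> measurable_fun setT b ->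
  measurable_fun setT (fun w => num_inside u (a w) (b w) w).
Proof.
move=> ma mb; apply: measurable_card => i.
by apply: measurable_and; exact: measurable_fun_ler.
Qed.

Lemma first_hit1SP (x : nat -> R) m : first_hit1 x = m.+1 <->
  x m.+1 = 1 /\ forall i, (i < m.+1)%N -> x i <> 1.
Proof.
split=> [|[? ?]]; last exact: first_hit1E.
by rewrite /first_hit1; case: xgetP => [k kE [xk xki] <-|].
Qed.

Lemma measurable_first_hit1 m : measurable [set w | first_hit1 (X^~ w) = m].
Proof.
have mS k : measurable [set w | first_hit1 (X^~ w) = k.+1].
  have mE i : measurable [set w | X i w == 1].
    by apply: measurable_bool; exact: measurable_fun_eqr.
  rewrite (_ : [set _ | _] = [set w | X k.+1 w == 1] `&`
      \bigcap_(i in [set i | (i < k.+1)%N]) ~` [set w | X i w == 1]).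
    apply: measurableI => //; apply: bigcap_measurable; first by exists 0%N.
    by move=> i _; exact: measurableC.
  apply/seteqP; split => w /=.
    move=> /first_hit1SP[xk xki]; split; first exact/eqP.
    by move=> i /= ik /eqP; exact: xki.
  by move=> [/eqP xk xki]; apply/first_hit1SP; split => // i ik xi1;
    have := xki i ik; rewrite /= xi1 eqxx.
case: m => [|m]; last exact: mS.
rewrite (_ : [set _ | _] = ~` \bigcup_k [set w | first_hit1 (X^~ w) = k.+1]).
  by apply: measurableC; apply: bigcupT_measurable.
apply/seteqP; split => w /=; first by move=> w0 [k _ /=]; rewrite w0.
by case E : (first_hit1 _) => [|k]// []; exists k.
Qed.

Lemma seq_random_bivariate : seq_random (bivariate u X).
Proof.
apply: (seq_random_iota (N := fun w => first_hit1 (X^~ w)) (h := fun j w =>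
  (X j.+1 w - X j w, num_inside u (X j w) (X j.+1 w) w))).
  exact: measurable_first_hit1.
move=> j; apply: measurable_fun_pair; first exact: measurable_funB.
exact: measurable_num_inside.
Qed.

End BivariateMeasurability.

Section BivariateLaw.
Context d (Omega : measurableType d) (R : realType) (P : probability Omega R).
Context (n : nat) (u : 'I_n.+1 -> {RV P >-> R}).
Hypothesis hu : exchangeable_partition u.

Let u01 w : u ord0 w = 0 /\ u ord_max w = 1.
Proof. by have [] := hu. Qed.

Let u_incr w (i j : 'I_n.+1) : (i < j)%N -> u i w < u j w.
Proof. by have [_ + _ _] := hu; apply. Qed.

Local Notation utuple := (utuple u).
Local Notation Y w := (tnth (ytuple u w)).
Local Notation positions := (enum 'I_n).

(** A chain [X] moves through the endpoints with step probabilities [q], which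
    make [pX y ss] the probability of the blocks [ss] when [y] are the lengths of
    the intervals. *)
Variables (X : nat -> Omega -> R) (q : n.+1.-tuple R -> nat -> nat -> R).
Variable pX : ('I_n -> R) -> seq (seq 'I_n) -> R.
Hypothesis mX : forall j, measurable_fun setT (X j).
Hypothesis X0 : forall w, X 0%N w = 0.
Hypothesis mq : forall i k, measurable_fun setT (fun z => q z i k).
Hypothesis q0 : forall w i k, (0 < k)%N -> (i + k <= n)%N -> 0 <= q (utuple w) i k.
Hypothesis X_step : forall c k (A : set (n.+1.-tuple R)),
  0%N \notin c -> (0 < k)%N -> (sumn c + k <= n)%N -> measurable A ->
  P (visit u X (rcons c k) `&` utuple @^-1` A) =
  (\int[P]_(w in visit u X c `&` utuple @^-1` A)
     (q (utuple w) (sumn c) k)%:E)%E.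
Hypothesis qE : forall w c, c \in compositions n ->
  path_prob q (utuple w) 0 c = pX (tnth (ltuple u w)) (reshape c positions).
Hypothesis mpX : forall ss, measurable_fun setT (fun t : n.-tuple R => pX (tnth t) ss).
Hypothesis pX0 : forall y ss, (forall i, 0 < y i) -> 0 <= pX y ss.
Hypothesis pX_map : forall y (f : 'I_n -> 'I_n) ss,
  pX (y \o f) ss = pX y [seq [seq f i | i <- b] | b <- ss].
Hypothesis pX_shape : forall y c, (forall i, 0 < y i) -> c \in compositions n ->
  \sum_(s <- permutations positions) pX y (reshape c s) =
  n`!%:R * inv_tails [seq k%:R | k <- c].

Implicit Types (Psi : seq (R * nat) -> R).

Lemma measurable_blocks Psi ss : seq_mfun Psi ->
  measurable_fun setT (fun t : n.-tuple R => Psi (blocks (tnth t) ss)).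
Proof.
move=> mPsi; apply: (measurable_seq_mfun_map _ (h := fun (b : seq 'I_n)
  (t : n.-tuple R) => (mass (tnth t) b, size b))) => // b.
apply: measurable_fun_pair; last exact: measurable_cst.
by apply: measurable_sum => i; exact: measurable_tnth.
Qed.

Lemma blocks_map (y : 'I_n -> R) (f : 'I_n -> 'I_n) ss :
  blocks (y \o f) ss = blocks y [seq [seq f i | i <- b] | b <- ss].
Proof.
rewrite /blocks -map_comp; apply: eq_map => b /=.
by rewrite /mass big_map size_map.
Qed.

Lemma visit_integral c Psi : c \in compositions n ->
  seq_mfun Psi -> (forall z, 0 <= Psi z) ->
  (\int[P]_w (\1_(visit u X c) w * Psi (bivariate u X w))%:E =
   \int[P]_w (n`!%:R^-1 * \sum_(s <- permutations positions)
     pX (Y w) (reshape c s) * Psi (blocks (Y w) (reshape c s)))%:E)%E.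
Proof.
move=> cn mPsi Psi0; have := cn; rewrite mem_compositions => /andP[c0 /eqP sc].
pose ss := reshape c positions.
pose yz (z : n.+1.-tuple R) : n.-tuple R := [tuple endpt z i.+1 - endpt z i | i < n].
have yzE w : yz (utuple w) = ltuple u w.
  by apply: eq_from_tnth => i; rewrite yE tnth_mktuple.
have myz : measurable_fun setT yz.
  apply/measurable_fun_tnthP => i.
  rewrite (_ : _ \o _ = fun z => endpt z i.+1 - endpt z i).
    by apply: measurable_funB; exact: measurable_endpt.
  by apply/funext => z; rewrite /= tnth_mktuple.
transitivity (\int[P]_w (\1_(visit u X c) w * Psi (blocks (tnth (yz (utuple w))) ss))%:E)%E.
  apply: eq_integral => w _; rewrite indicE; case: (boolP (w \in _)).
    by rewrite inE => vw; rewrite (bivariate_visit hu cn vw) yzE.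
  by rewrite !mul0r.
rewrite (path_law_integral u01 mq q0 mX X0 X_step c0 (g := fun z =>
    Psi (blocks (tnth (yz z)) ss))) ?sc//; last first.
  exact: (measurableT_comp (measurable_blocks ss mPsi) myz).
under eq_integral do rewrite qE// yzE.
rewrite (@exchangeable_integral _ _ _ P n u hu (fun t : n.-tuple R =>
    pX (tnth t) ss * Psi (blocks (tnth t) ss))).
- apply: eq_integral => w _; congr (_ * _)%:E.
  have uo : uniq (ord_tuple n) by rewrite val_ord_tuple enum_uniq.
  rewrite -[in RHS]val_ord_tuple -(big_perm_tuple _ uo).
  apply: eq_bigr => s _.
  have -> : tnth [tuple tnth (ytuple u w) (s i) | i < n] = Y w \o s.
    by apply/funext => i; rewrite tnth_mktuple.
  rewrite pX_map blocks_map /ss map_reshape.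
  by under [in RHS]eq_map do rewrite tnth_ord_tuple.
- by apply: measurable_funM; [exact: mpX|exact: measurable_blocks].
- by move=> t t0; rewrite mulr_ge0// pX0.
Qed.

(** Averaging over the lengths, the composition followed by the chain has the
    law of the composition followed by the T-chain. *)
Lemma visit_prob c : c \in compositions n ->
  P (visit u X c) = (inv_tails [seq k%:R | k <- c])%:E.
Proof.
move=> cn; have mv := measurable_visit u c mX.
rewrite -[visit u X c]setIT -integral_indic//.
transitivity (\int[P]_w (\1_(visit u X c) w * 1)%:E)%E.
  by apply: eq_integral => w _; rewrite mulr1.
rewrite (@visit_integral c (fun=> 1))//.
transitivity (\int[P]_w cst (inv_tails [seq (k%:R : R) | k <- c])%:E w)%E.
  apply: eq_integral => w _ /=; congr EFin.
  under eq_bigr do rewrite mulr1.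
  by rewrite pX_shape ?mulKf ?pnatr_eq0 -?lt0n ?fact_gt0// => i; exact: ytuple_gt0.
by rewrite integral_cst// [X in (_ * X)%E]probability_setT mule1.
Qed.

Lemma visit_trivIset : trivIset [set` compositions n] (visit u X).
Proof.
apply/trivIsetP => c c' cn c'n cc'; apply/seteqP; split => // w [vc vc'].
have shE b : b \in compositions n -> visit u X b w ->
    [seq p.2 | p <- bivariate u X w] = b.
  move=> bn vb; rewrite (bivariate_visit hu bn vb) -map_comp.
  rewrite -[RHS](@reshapeKl _ b positions)//.
  by move: bn; rewrite mem_compositions size_enum_ord => /andP[_ /eqP ->].
by move/eqP: cc'; apply; rewrite -(shE c cn vc) (shE c' c'n vc').
Qed.

(** Almost surely, the chain visits the endpoints along some composition. *)
Lemma sum_visit_prob : (\sum_(c <- compositions n) P (visit u X c) = 1)%E.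
Proof.
rewrite big_seq (eq_bigr (fun c => (inv_tails [seq (k%:R : R) | k <- c])%:E)).
  by rewrite -big_seq sumEFin sum_compositions_inv_tails.
by move=> c cn; exact: visit_prob.
Qed.

Lemma bivariate_integral_visit Psi : seq_mfun Psi -> (forall z, 0 <= Psi z) ->
  (\int[P]_w (Psi (bivariate u X w))%:E = \sum_(c <- compositions n)
    \int[P]_w (\1_(visit u X c) w * Psi (bivariate u X w))%:E)%E.
Proof.
move=> mPsi Psi0; apply: integral_cover => //.
- by move=> c; exact: measurable_visit.
- exact: compositions_uniq.
- exact: visit_trivIset.
- exact: sum_visit_prob.
- exact: measurable_seq_mfun mPsi (seq_random_bivariate u mX).
Qed.

(** The law of the counts is the same for every chain of this kind. *)
Lemma counts_law (A : set (seq nat)) : seq_measurable A ->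
  P (counts (bivariate u X) @^-1` A) =
  (\sum_(c <- compositions n) \1_A c * inv_tails [seq k%:R | k <- c])%:E.
Proof.
move=> mA; pose A' := [set z : seq (R * nat) | A [seq p.2 | p <- z]].
have mA' : seq_measurable A' by exact: seq_measurable_map.
have mB := seq_random_bivariate u mX mA'.
rewrite (_ : _ @^-1` A = bivariate u X @^-1` A')//.
rewrite -[_ @^-1` A']setIT -integral_indic//.
transitivity (\int[P]_w ((\1_A' : seq (R * nat) -> R) (bivariate u X w))%:E)%E.
  by [].
rewrite bivariate_integral_visit//; last exact: seq_mfun_indic.
rewrite -sumEFin big_seq [RHS]big_seq; apply: eq_bigr => c cn.
have mv := measurable_visit u c mX.
transitivity (\int[P]_(w in visit u X c) (\1_A c)%:E)%E.
  rewrite [RHS]mul_indic_integral; apply: eq_integral => w _.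
  rewrite !indicE; case: (boolP (w \in visit _ _ _)); rewrite ?mul0r//.
  rewrite inE => vw; rewrite !mul1r; congr ((nat_of_bool _)%:R)%:E.
  have -> : (c \in A) = ([seq p.2 | p <- bivariate u X w] \in A).
    rewrite (bivariate_visit hu cn vw) -map_comp.
    rewrite -[in LHS](@reshapeKl _ c positions)//.
    by move: cn; rewrite mem_compositions size_enum_ord => /andP[_ /eqP ->].
  by apply/idP/idP; rewrite !inE.
by rewrite integral_cst// [X in (_ * X)%E]visit_prob// EFinM.
Qed.

(** The mean first length is the mean first step. The absolute value and the
    default value 0 of an empty sequence play no role, almost surely. *)
Lemma first_length_integral :
  (forall w, \sum_(k < n) q (utuple w) 0 k.+1 = 1) ->
  (\int[P]_w (`|head 0 (lengths (bivariate u X) w)|)%:E =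
   \int[P]_w (\sum_(k < n) q (utuple w) 0 k.+1 * endpt (utuple w) k.+1)%:E)%E.
Proof.
move=> q1; have n0 : (0 < n)%N by exact: (n_gt0 u01 (inhabits point)).
pose Psi (z : seq (R * nat)) := `|head 0 [seq p.1 | p <- z]|.
have mPsi : seq_mfun Psi.
  move=> m; apply: measurableT_comp => //.
  rewrite (_ : (fun _ => _) = fun t : m.-tuple (R * nat) => (nth (0, 0%N) t 0).1).
    exact: (measurableT_comp measurable_fst (measurable_nth _ _)).
  by apply/funext => -[[|p t] i].
have mX1 : measurable_fun setT (fun w => `|X 1%N w|) by exact: measurableT_comp.
have e0 w k : (k <= n)%N -> 0 <= endpt (utuple w) k.
  by move=> kn; rewrite -(endpt0 u01 w) endpt_le.
have Psi0 z : 0 <= Psi z by exact: normr_ge0.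
transitivity (\int[P]_w (Psi (bivariate u X w))%:E)%E; first by [].
rewrite bivariate_integral_visit//.
transitivity (\sum_(c <- compositions n)
    \int[P]_w (\1_(visit u X c) w * `|X 1%N w|)%:E)%E.
  rewrite big_seq [RHS]big_seq; apply: eq_bigr => c cn.
  apply: eq_integral => w _; rewrite indicE; case: (boolP (w \in _)); last first.
    by rewrite !mul0r.
  rewrite inE => vw; rewrite !mul1r (bivariate_visit hu cn vw); congr (_%:E).
  move: cn vw; rewrite mem_compositions => /andP[c0 /eqP sc].
  case: c c0 sc => [|k c] c0 sc vw; first by rewrite -sc in n0.
  rewrite /Psi /= (vw 1%N)//= take0 /= addn0.
  rewrite -{1}(drop0 positions) mass_interval ?add0n ?(endpt0 u01) ?subr0//.
  by rewrite -sc /= leq_addr.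
rewrite -(@integral_cover _ _ _ P); last 6 first.
- by move=> c; exact: measurable_visit.
- exact: compositions_uniq.
- exact: visit_trivIset.
- exact: sum_visit_prob.
- exact: mX1.
- by [].
pose F (k : 'I_n) := visit u X [:: k.+1].
have PF k : (P (F k) = \int[P]_w (q (utuple w) 0 k.+1)%:E)%E.
  have := path_law u01 mq q0 mX X0 X_step (c := [:: k.+1]) (A := setT) isT.
  rewrite /= addn0 preimage_setT setIT => -> //.
  by apply: eq_integral => w _; rewrite mulr1.
have mqu k : measurable_fun setT (fun w => q (utuple w) 0 k).
  exact: (measurableT_comp (mq 0 k) (measurable_utuple u)).
have qge0 w (k : 'I_n) : 0 <= q (utuple w) 0 k.+1.
  by apply: q0 => //; exact: ltn_ord.
rewrite (@integral_cover _ _ _ P _ (enum 'I_n) F).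
- transitivity (\sum_(k < n)
      \int[P]_w (q (utuple w) 0 k.+1 * endpt (utuple w) k.+1)%:E)%E.
    rewrite big_enum/=; apply: eq_bigr => k _.
    transitivity (\int[P]_w (\1_(F k) w * `|endpt (utuple w) k.+1|)%:E)%E.
      apply: eq_integral => w _; rewrite indicE; case: (boolP (w \in _)).
        by rewrite inE => vw; rewrite (vw 1%N)//= addn0.
      by rewrite !mul0r.
    rewrite (path_law_integral u01 mq q0 mX X0 X_step (c := [:: k.+1])
      (g := fun z => `|endpt z k.+1|))//=.
    + apply: eq_integral => w _; rewrite mulr1 ger0_norm//; exact: e0.
    + by rewrite addn0.
    + by apply: measurableT_comp => //; exact: measurable_endpt.
  rewrite -ge0_integral_sum//.
  + by apply: eq_integral => w _; rewrite sumEFin.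
  + by move=> k; apply/measurable_EFinP/measurable_funM => //; exact: measurable_endptu.
  + by move=> k w _; rewrite lee_fin mulr_ge0// e0.
- by move=> k; exact: measurable_visit.
- exact: enum_uniq.
- apply/trivIsetP => k k' _ _ kk'; apply/seteqP; split => // w [].
  move=> vk vk'; have := vk 1%N isT; rewrite (vk' 1%N isT) /= !addn0 => E.
  move/eqP: kk'; apply; apply/val_inj/succn_inj/esym.
  by apply: (endpt_inj u_incr _ _ E); exact: ltn_ord.
- rewrite big_enum/= (eq_bigr (fun k : 'I_n => \int[P]_w (q (utuple w) 0 k.+1)%:E)%E)//.
  rewrite -ge0_integral_sum//.
  + transitivity (\int[P]_w cst 1%:E w)%E.
      by apply: eq_integral => w _; rewrite sumEFin q1.
    by rewrite integral_cst// [X in (_ * X)%E]probability_setT mule1.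
  + by move=> k; apply/measurable_EFinP.
  + by move=> k w _; rewrite lee_fin.
- exact: mX1.
- by [].
Qed.

(** The law of the bivariate sequence, as a sum over all ordered set partitions
    of the decreasing sequence of lengths. *)
Lemma bivariate_integral Psi : seq_mfun Psi -> (forall z, 0 <= Psi z) ->
  (\int[P]_w (Psi (bivariate u X w))%:E = \int[P]_w (n`!%:R^-1 *
    \sum_(ss <- cut_arrangements positions)
      pX (Y w) ss * Psi (blocks (Y w) ss))%:E)%E.
Proof.
move=> mPsi Psi0; rewrite bivariate_integral_visit//.
pose G c w := n`!%:R^-1 * \sum_(s <- permutations positions)
     pX (Y w) (reshape c s) * Psi (blocks (Y w) (reshape c s)).
have mYc (g : n.-tuple R -> R) : measurable_fun setT g ->
    measurable_fun setT (fun w => g (ytuple u w)).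
  by move=> mg; exact: (measurableT_comp mg (measurable_ytuple u)).
have mG c : measurable_fun setT (G c).
  apply: measurable_funM; first exact: measurable_cst.
  apply: (mYc (fun t => \sum_(s <- permutations positions)
     pX (tnth t) (reshape c s) * Psi (blocks (tnth t) (reshape c s)))).
  apply: measurable_sum => s; apply: measurable_funM; first exact: mpX.
  exact: measurable_blocks.
have G0 c w : 0 <= G c w.
  rewrite mulr_ge0 ?invr_ge0// sumr_ge0// => s _; rewrite mulr_ge0// pX0// => i.
  exact: (ytuple_gt0 hu).
transitivity (\sum_(c <- compositions n) \int[P]_w (G c w)%:E)%E.
  by rewrite big_seq [RHS]big_seq; apply: eq_bigr => c cn; exact: visit_integral.
rewrite -ge0_integral_sum//.
- apply: eq_integral => w _; rewrite sumEFin; congr EFin.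
  rewrite /G -mulr_sumr; congr (_ * _).
  by rewrite big_allpairs_dep size_enum_ord.
- by move=> c; exact/measurable_EFinP.
- by move=> c w _; rewrite lee_fin.
Qed.

End BivariateLaw.

Section RankedLaw.
Context d (Omega : measurableType d) (R : realType) (P : probability Omega R).
Context (n : nat) (Y : Omega -> 'I_n -> R) (X : Omega -> seq (R * nat)).
Variable wt : R * nat -> R.
Hypothesis Y0 : forall w i, 0 < Y w i.
Hypothesis rX : seq_random X.
Hypothesis mwt : measurable_fun setT wt.
Hypothesis wt_gt0 : forall p, 0 < p.1 /\ (0 < p.2)%N -> 0 < wt p.
Hypothesis XE : forall Psi, seq_mfun Psi -> (forall z, 0 <= Psi z) ->
  (\int[P]_w (Psi (X w))%:E =
   \int[P]_w (n`!%:R^-1 * biased_sum (Y w) wt (enum 'I_n) Psi)%:E)%E.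

Let rank_indic (A : set (seq (R * nat))) z : R := \1_A (sort (@longer R) z).

Let rank_indic_perm (A : set (seq (R * nat))) z z' :
  perm_eq z z' -> rank_indic A z = rank_indic A z'.
Proof. by move=> zz'; rewrite /rank_indic (sort_longer_perm zz'). Qed.

Let rank_indic_mfun A : seq_measurable A -> seq_mfun (rank_indic A).
Proof.
move=> mA; apply: (seq_mfun_indic (A := [set z | A (sort (@longer R) z)])).
exact: seq_measurable_ranked.
Qed.

(** The law of the length-ranking does not depend on the bias [wt]. *)
Lemma ranked_law A : seq_measurable A ->
  P (ranked X @^-1` A) = (\int[P]_w (n`!%:R^-1 *
    \sum_(ss <- cut_arrangements (enum 'I_n))
      (size ss)`!%:R^-1 * inv_sizes R ss * \1_A (sort (@longer R) (blocks (Y w) ss)))%:E)%E.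
Proof.
move=> mA; have mi := rank_indic_mfun mA.
have mrA : measurable (ranked X @^-1` A).
  exact: (rX (seq_measurable_ranked mA)).
rewrite -[ranked X @^-1` A]setIT -integral_indic//.
transitivity (\int[P]_w (rank_indic A (X w))%:E)%E; first by [].
rewrite (XE mi)//; apply: eq_integral => w _; congr (_ * _)%:E.
by apply: biased_sum_symmetric (rank_indic_perm A).
Qed.

(** The biased mean of a nonnegative function is nonnegative when the weights
    are positive, which holds almost surely only. *)
Lemma biased_mean_ge0_ae (B : set (seq (R * nat))) : seq_measurable B ->
  {ae P, forall w, 0 <= biased_mean (0, 0%N) wt (\1_B) (X w)}.
Proof.
move=> mB; set bm := biased_mean _ _ _.
have mbm : seq_mfun bm by apply: seq_mfun_biased_mean => //; exact: seq_mfun_indic.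
pose bad := [set z | bm z < 0].
have mbad : seq_measurable bad.
  move=> m; have m0 : measurable_fun setT (fun _ : m.-tuple (R * nat) => 0 : R).
    exact: measurable_cst.
  have := measurable_fun_ltr (mbm m) m0.
  by move=> /(_ measurableT [set true] Logic.I); rewrite setTI.
exists (X @^-1` bad); split; [exact: rX| |].
- rewrite -[X @^-1` bad]setIT -integral_indic//; last exact: rX.
  transitivity (\int[P]_w ((\1_bad : seq (R * nat) -> R) (X w))%:E)%E; first by [].
  rewrite XE//; last exact: seq_mfun_indic.
  rewrite (eq_integral (cst 0%E)) ?integral0// => w _ /=; congr EFin.
  rewrite /biased_sum big_seq big1 ?mulr0// => ss ssL.
  rewrite [biased_mean _ _ _ _](_ : _ = 0) ?mulr0//.
  rewrite /biased_mean big_seq big1// => t; rewrite mem_permutations => tz.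
  have pz := perm_map_nth (0, 0%N) tz.
  rewrite [\1_bad _](_ : _ = 0) ?mulr0// indicE [_ \in _](_ : _ = false)//.
  apply/negbTE; rewrite notin_setE /bad /= ltNge; apply/negP; rewrite negbK.
  apply: biased_mean_ge0 => //.
  move=> p; rewrite (perm_mem pz) => pss; apply: wt_gt0.
  by apply: blocks_gt0 ssL _ pss => i _; exact: Y0.
- by move=> w /=; rewrite leNgt => /negP; rewrite negbK.
Qed.

(** Given its length-ranking, the sequence is in [wt]-biased order. *)
Lemma ranked_biased_order : is_biased_order P wt X (ranked X).
Proof.
move=> A B mA mB; have mi := rank_indic_mfun mA.
set bm := biased_mean (0, 0%N) wt (\1_B).
have mbm : seq_mfun bm by apply: seq_mfun_biased_mean => //; exact: seq_mfun_indic.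
have mabm : seq_mfun (fun z => `|bm z|).
  by move=> m; apply: measurableT_comp => //; exact: mbm.
have mrA : measurable (ranked X @^-1` A).
  exact: (rX (seq_measurable_ranked mA)).
have mB' : measurable (X @^-1` B) by exact: rX.
transitivity (\int[P]_w (rank_indic A (X w) * \1_B (X w))%:E)%E.
  rewrite -[_ `&` _]setIT -integral_indic//; last exact: measurableI.
  by apply: eq_integral => w _; rewrite indicI.
rewrite (XE (Psi := fun z => rank_indic A z * \1_B z)); last 2 first.
- by apply: seq_mfunM => //; exact: seq_mfun_indic.
- by move=> z; rewrite mulr_ge0.
(* The absolute value makes the integrand nonnegative everywhere. *)
transitivity (\int[P]_w (rank_indic A (X w) * `|bm (X w)|)%:E)%E.
  rewrite (XE (Psi := fun z => rank_indic A z * `|bm z|)); last 2 first.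
  - exact: seq_mfunM.
  - by move=> z; rewrite mulr_ge0.
  apply: eq_integral => w _; congr (_ * _)%:E.
  have YL : {in enum 'I_n, forall i, 0 < Y w i} by move=> i _; exact: Y0.
  rewrite (biased_sum_mean YL wt_gt0 _ (rank_indic_perm A)).
  have rp := rank_indic_perm A.
  rewrite [RHS](biased_sum_symmetric YL wt_gt0); last first.
    by move=> z z' zz'; rewrite (rp _ _ zz') /bm (biased_mean_perm _ _ _ zz').
  rewrite [LHS](biased_sum_symmetric YL wt_gt0); last first.
    by move=> z z' zz'; rewrite (rp _ _ zz') (biased_mean_perm _ _ _ zz').
  rewrite big_seq [RHS]big_seq; apply: eq_bigr => ss ssL; congr (_ * (_ * _)).
  rewrite ger0_norm//; apply: biased_mean_ge0 => // p pss.
  exact: wt_gt0 (blocks_gt0 YL ssL pss).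
rewrite [RHS]mul_indic_integral; apply: ae_eq_integral => //.
- apply/measurable_EFinP; apply: (measurable_seq_mfun (Psi := fun z =>
    rank_indic A z * `|bm z|)) => //; exact: seq_mfunM.
- apply/measurable_EFinP; apply: measurable_funM; first exact: measurable_indic.
  rewrite (_ : (fun _ => _) = fun w => bm (X w)).
    exact: measurable_seq_mfun.
  apply/funext => w; rewrite (biased_kernelE (0, 0%N)) /ranked.
  by apply: biased_mean_perm; rewrite perm_sort.
have := biased_mean_ge0_ae mB; apply: filterS => w bm0 _.
rewrite (biased_kernelE (0, 0%N)) ger0_norm//; congr (_ * _)%:E.
by rewrite /bm; apply/esym/biased_mean_perm; rewrite perm_sort.
Qed.

End RankedLaw.

(** * The D- and T-partitions *)

Section PathFacts.
Context (R : realType) (n : nat).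
Implicit Types (y : 'I_n -> R) (ss : seq (seq 'I_n)).

Lemma pathD_ge0 y ss : (forall i, 0 < y i) -> 0 <= pathD y ss.
Proof.
move=> y0; rewrite mulr_ge0//.
  rewrite prodr_ge0// => b _; rewrite /last_mass.
  by case/lastP: b => [|b i]//; rewrite map_rcons last_rcons ltW.
apply: inv_tails_ge0 => _ /mapP[b _ ->].
by rewrite sumr_ge0// => i _; rewrite ltW.
Qed.

Lemma pathD_map y (f : 'I_n -> 'I_n) ss :
  pathD (y \o f) ss = pathD y [seq [seq f i | i <- b] | b <- ss].
Proof.
rewrite /pathD big_map -map_comp; congr (_ * inv_tails _).
  by apply: eq_bigr => b _; rewrite /last_mass -map_comp.
by apply: eq_map => b /=; rewrite /mass big_map.
Qed.

Lemma measurable_pathD ss :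
  measurable_fun setT (fun t : n.-tuple R => pathD (tnth t) ss).
Proof.
apply: measurable_funM.
  apply: measurable_prod => b _; rewrite /last_mass.
  case/lastP: b => [|b i]; first exact: measurable_cst.
  under eq_fun do rewrite map_rcons last_rcons.
  exact: measurable_tnth.
apply: (measurable_inv_tails _ (h := fun b (t : n.-tuple R) => mass (tnth t) b)) => b.
by apply: measurable_sum => i; exact: measurable_tnth.
Qed.

Lemma sum_pathT_shape c : c \in compositions n ->
  \sum_(s <- permutations (enum 'I_n)) pathT R (reshape c s) =
  n`!%:R * inv_tails [seq k%:R | k <- c].
Proof.
move=> cn; rewrite big_seq.
rewrite (eq_bigr (fun=> inv_tails [seq k%:R | k <- c])) => [|s]; last first.
  rewrite mem_permutations => /perm_size; rewrite size_enum_ord => sn.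
  by rewrite pathT_reshape// sn.
rewrite -big_seq big_const_seq count_predT iter_addr_0.
by rewrite size_permutations ?enum_uniq// size_enum_ord mulr_natl.
Qed.

Lemma pathT_ge0 ss : 0 <= pathT R ss.
Proof. by apply: inv_tails_ge0 => _ /mapP[b _ ->]. Qed.

Lemma pathT_map (f : 'I_n -> 'I_n) ss :
  pathT R ss = pathT R [seq [seq f i | i <- b] | b <- ss].
Proof.
rewrite /pathT -map_comp; congr inv_tails; apply: eq_map => b /=.
by rewrite size_map.
Qed.

End PathFacts.

(** Twice the sum over a triangle, diagonal included. *)
Lemma sum_triangle (R : comPzRingType) n (b : 'I_n -> R) :
  2 * (\sum_k b k * \sum_(i < n | (i <= k)%N) b i) =
  (\sum_i b i) ^+ 2 + \sum_i b i ^+ 2.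
Proof.
pose S := \sum_k b k * \sum_(i < n | (i <= k)%N) b i.
have SE : S = \sum_k b k * \sum_(i < n | (k <= i)%N) b i.
  rewrite /S; under eq_bigr do rewrite mulr_sumr.
  rewrite (exchange_big_dep xpredT)//=; apply: eq_bigr => k _.
  by rewrite mulr_sumr; apply: eq_bigr => i _; rewrite mulrC.
rewrite -/S mulr_natl mulr2n {2}SE /S -big_split/= expr2 mulr_suml -big_split/=.
apply: eq_bigr => k _; rewrite -mulrDr -mulrDr; congr (_ * _).
rewrite [in RHS](bigID (fun i : 'I_n => (i <= k)%N))/= -addrA; congr (_ + _).
rewrite (bigD1 k)//= addrC; congr (_ + _); apply: eq_bigl => i.
by rewrite -ltnNge ltn_neqAle andbC eq_sym.
Qed.

(** The item at a given position of a uniformly permuted family is uniform. *)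
Lemma mean_perm (R : numFieldType) n (y : 'I_n -> R) (i : 'I_n) :
  n`!%:R^-1 * \sum_(s : 'S_n) y (s i) = n%:R^-1 * \sum_j y j.
Proof.
have same j : \sum_(s : 'S_n) y (s j) = \sum_(s : 'S_n) y (s i).
  rewrite (reindex_inj (mulgI (tperm i j))); apply: eq_bigr => s _.
  by rewrite permM tpermR.
have n0 : (n%:R : R) != 0 by rewrite pnatr_eq0 -lt0n (leq_ltn_trans _ (ltn_ord i)).
have : \sum_(j < n) \sum_(s : 'S_n) y (s j) = n`!%:R * \sum_j y j.
  rewrite exchange_big/= (eq_bigr (fun=> \sum_j y j)) => [|s _].
    by rewrite sumr_const card_Sn mulr_natl.
  by rewrite [RHS](reindex_inj (@perm_inj _ s)).
rewrite (eq_bigr _ (fun j _ => same j)) sumr_const card_ord => E.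
by apply: (mulfI n0); rewrite mulVKf// mulrCA mulr_natl E mulKf// pnatr_eq0 -lt0n.
Qed.

Section TwoPartitions.
Context d (Omega : measurableType d) (R : realType) (P : probability Omega R).
Context (n : nat) (u : 'I_n.+1 -> {RV P >-> R}).
Variables (U T : nat -> {RV P >-> R}).
Hypothesis hu : exchangeable_partition u.
Hypothesis hU : uniform_inputs u U.
Hypothesis hT : T_chain u T.

Let u01 w : u ord0 w = 0 /\ u ord_max w = 1.
Proof. by have [] := hu. Qed.

Let u_incr w (i j : 'I_n.+1) : (i < j)%N -> u i w < u j w.
Proof. by have [_ + _ _] := hu; apply. Qed.

Local Notation utuple := (utuple u).
Local Notation Y w := (tnth (ytuple u w)).
Local Notation D_seq := (bivariate u (DV u U)).
Local Notation T_seq := (bivariate u (fun j => T j)).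

Let mT j : measurable_fun setT (T j : Omega -> R). Proof. by []. Qed.

Let T0 w : T 0%N w = 0. Proof. by have [] := hT. Qed.

Let n_pos : (0 < n)%N. Proof. exact: (n_gt0 u01 (inhabits point)). Qed.

Let D_step := DV_law_step u01 u_incr hU.
Let T_step := T_law_step u01 u_incr hT.

Let D_ge0 w i k : (0 < k)%N -> (i + k <= n)%N -> 0 <= D_step_prob (utuple w) i k.
Proof. exact: D_step_prob_ge0. Qed.

Let T_ge0 w i k : (0 < k)%N -> (i + k <= n)%N -> 0 <= T_step_prob (utuple w) i k.
Proof. by move=> _ _; rewrite invr_ge0. Qed.

Let D_path w c : c \in compositions n ->
  path_prob (@D_step_prob R n) (utuple w) 0 c =
  pathD (tnth (ltuple u w)) (reshape c (enum 'I_n)).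
Proof.
rewrite mem_compositions => /andP[c0 /eqP cn].
by rewrite (path_prob_D hu) ?drop0.
Qed.

Let T_path w c : c \in compositions n ->
  path_prob (@T_step_prob R n) (utuple w) 0 c =
  pathT R (reshape c (enum 'I_n)).
Proof.
move=> cn; rewrite pathT_reshape ?size_enum_ord//.
by move: cn; rewrite mem_compositions => /andP[c0 /eqP cn]; rewrite path_prob_T.
Qed.

Let D_shape (y : 'I_n -> R) c : (forall i, 0 < y i) -> c \in compositions n ->
  \sum_(s <- permutations (enum 'I_n)) pathD y (reshape c s) =
  n`!%:R * inv_tails [seq k%:R | k <- c].
Proof.
move=> y0 cn; rewrite sum_pathD_shape ?enum_uniq ?size_enum_ord//.
Qed.

Let mD_step := @measurable_D_step_prob R n.

Let mT_step i k : measurable_fun setT (fun z => @T_step_prob R n z i k).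
Proof. exact: measurable_cst. Qed.

Lemma D_integral Psi : seq_mfun Psi -> (forall z, 0 <= Psi z) ->
  (\int[P]_w (Psi (D_seq w))%:E =
   \int[P]_w (n`!%:R^-1 *
     biased_sum (Y w) (fun p => p.1) (enum 'I_n) Psi)%:E)%E.
Proof.
move=> mPsi Psi0; rewrite (bivariate_integral hu (measurable_DV u01 u_incr U)
  (fun=> erefl) mD_step D_ge0 D_step D_path (@measurable_pathD R n)
  (@pathD_ge0 R n) (@pathD_map R n) D_shape)//.
by apply: eq_integral => w _; rewrite sum_pathD.
Qed.

Lemma T_integral Psi : seq_mfun Psi -> (forall z, 0 <= Psi z) ->
  (\int[P]_w (Psi (T_seq w))%:E =
   \int[P]_w (n`!%:R^-1 *
     biased_sum (Y w) (fun p => p.2%:R) (enum 'I_n) Psi)%:E)%E.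
Proof.
move=> mPsi Psi0; rewrite (bivariate_integral hu mT T0 mT_step T_ge0 T_step
  (pX := fun=> @pathT R _) T_path (fun=> @measurable_cst _ _ _ _ _ _)
  (fun _ ss _ => pathT_ge0 R ss) (fun=> @pathT_map R n)
  (fun _ c _ => @sum_pathT_shape R n c))//.
by apply: eq_integral => w _; rewrite sum_pathT.
Qed.

Let rD : seq_random D_seq.
Proof. by apply: seq_random_bivariate; exact: measurable_DV. Qed.

Let rT : seq_random T_seq.
Proof. exact: seq_random_bivariate. Qed.

Let Y0 w i : 0 < Y w i. Proof. exact: (ytuple_gt0 hu). Qed.

Let mwD : measurable_fun setT (fun p : R * nat => p.1).
Proof. exact: measurable_fst. Qed.

Let mwT : measurable_fun setT (fun p : R * nat => p.2%:R : R).
Proof. by apply: (@measurableT_comp _ _ _ _ _ _ (fun k : nat => k%:R : R) setT snd). Qed.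

Let wD_gt0 (p : R * nat) : 0 < p.1 /\ (0 < p.2)%N -> 0 < p.1.
Proof. by case. Qed.

Let wT_gt0 (p : R * nat) : 0 < p.1 /\ (0 < p.2)%N -> 0 < p.2%:R :> R.
Proof. by case=> _; rewrite ltr0n. Qed.

Lemma ranked_same_law : same_law P (ranked D_seq) (ranked T_seq).
Proof.
move=> A mA; rewrite (ranked_law Y0 rD wD_gt0 D_integral mA).
by rewrite (ranked_law Y0 rT wT_gt0 T_integral mA).
Qed.

Lemma D_biased_order : is_biased_order P (fun p => p.1) D_seq (ranked D_seq).
Proof. exact: (ranked_biased_order Y0 rD mwD wD_gt0 D_integral). Qed.

Lemma T_biased_order : is_biased_order P (fun p => p.2%:R) T_seq (ranked T_seq).
Proof. exact: (ranked_biased_order Y0 rT mwT wT_gt0 T_integral). Qed.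

Lemma counts_same_law : same_law P (counts D_seq) (counts T_seq).
Proof.
move=> A mA; rewrite (counts_law hu (measurable_DV u01 u_incr U)
  (fun=> erefl) mD_step D_ge0 D_step D_path (@measurable_pathD R n)
  (@pathD_ge0 R n) (@pathD_map R n) D_shape mA).
by rewrite (counts_law hu mT T0 mT_step T_ge0 T_step
  (pX := fun=> @pathT R _) T_path (fun=> @measurable_cst _ _ _ _ _ _)
  (fun _ ss _ => pathT_ge0 R ss) (fun=> @pathT_map R n)
  (fun _ c _ => @sum_pathT_shape R n c) mA).
Qed.

Local Notation len w i := (tnth (ltuple u w) i).

Let endpt_sum w (k : 'I_n) :
  endpt (utuple w) k.+1 = \sum_(i < n | (i <= k)%N) len w i.
Proof.
pose F j := endpt (utuple w) j.+1 - endpt (utuple w) j.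
rewrite (eq_bigr (F \o val)) => [|i _]; last by rewrite yE.
rewrite -(big_ord_widen n F (ltn_ord k)) -(big_mkord xpredT F) telescope_sumr//.
by rewrite (endpt0 u01) subr0.
Qed.

Let sum_len w : \sum_i len w i = 1.
Proof.
rewrite (eq_bigr (fun i : 'I_n => endpt (utuple w) i.+1 - endpt (utuple w) i)).
  rewrite -(big_mkord xpredT (fun i => endpt (utuple w) i.+1 - endpt (utuple w) i)).
  by rewrite telescope_sumr// (endpt0 u01) (endptn u01) subr0.
by move=> i _; rewrite yE.
Qed.

(* The first step of the D-chain ends at the right endpoint of the interval [k]
   with probability [len w k]. *)
Let D_mean :
  (\int[P]_w (`|head 0 (lengths D_seq w)|)%:E =
   \int[P]_w ((1 + \sum_i len w i ^+ 2) / 2)%:E)%E.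
Proof.
have stepE w (k : 'I_n) : D_step_prob (utuple w) 0 k.+1 = len w k.
  by rewrite /D_step_prob add0n (endpt0 u01) subr0 divr1 yE.
rewrite (first_length_integral hu (measurable_DV u01 u_incr U)
  (fun=> erefl) mD_step D_ge0 D_step D_path (@measurable_pathD R n)
  (@pathD_ge0 R n) (@pathD_map R n) D_shape).
  apply: eq_integral => w _; congr (_%:E).
  have := sum_triangle (fun i => len w i); rewrite sum_len expr1n => <-.
  rewrite [RHS]mulrAC divff ?mul1r ?pnatr_eq0//.
  by apply: eq_bigr => k _; rewrite stepE endpt_sum.
by move=> w; rewrite -(sum_len w); apply: eq_bigr => k _; exact: stepE.
Qed.

Let T_mean :
  (\int[P]_w (`|head 0 (lengths T_seq w)|)%:E = ((1 + n%:R^-1) / 2)%:E)%E.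
Proof.
have n0 : (n%:R : R) != 0 by rewrite pnatr_eq0 -lt0n.
have stepE w (k : 'I_n) : T_step_prob (utuple w) 0 k.+1 = n%:R^-1.
  by rewrite /T_step_prob subn0.
rewrite (first_length_integral hu mT T0 mT_step T_ge0 T_step
  (pX := fun=> @pathT R _) T_path (fun=> @measurable_cst _ _ _ _ _ _)
  (fun _ ss _ => pathT_ge0 R ss) (fun=> @pathT_map R n)
  (fun _ c _ => @sum_pathT_shape R n c)); last first.
  move=> w; rewrite (eq_bigr (fun=> n%:R^-1)) => [|k _]; last exact: stepE.
  by rewrite sumr_const card_ord -[LHS]mulr_natr mulVf.
pose g (t : n.-tuple R) := \sum_(k < n) n%:R^-1 * \sum_(i < n | (i <= k)%N) tnth t i.
transitivity (\int[P]_w (g (ltuple u w))%:E)%E.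
  apply: eq_integral => w _; congr (_%:E).
  by apply: eq_bigr => k _; rewrite stepE endpt_sum.
rewrite (exchangeable_integral hu); first last.
- move=> t t0; apply: sumr_ge0 => k _; rewrite mulr_ge0 ?invr_ge0//.
  by apply: sumr_ge0 => i _; rewrite ltW.
- apply: measurable_sum => k; apply: measurable_funM => //.
  under eq_fun do rewrite big_mkcond.
  apply: measurable_sum => i; case: (i <= k)%N; last exact: measurable_cst.
  exact: measurable_tnth.
transitivity (\int[P]_w cst ((1 + n%:R^-1) / 2 : R)%:E w)%E; last first.
  by rewrite integral_cst// [X in (_ * X)%E]probability_setT mule1.
apply: eq_integral => w _; congr (_%:E).
have sumY : \sum_i Y w i = 1.
  rewrite -(sum_len w).
  transitivity (\sum_(x <- longest_lengths u n w) x).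
    by rewrite -val_ytuple [RHS]big_tuple.
  rewrite (perm_big _ (longest_lengths_perm u w)) big_map big_enum/=.
  by apply: eq_bigr => i _; rewrite tnth_mktuple.
transitivity (\sum_(k < n) n%:R^-1 * \sum_(i < n | (i <= k)%N) (n%:R^-1 : R)).
  rewrite exchange_big/= mulr_sumr; apply: eq_bigr => k _.
  rewrite -mulr_sumr mulrCA; congr (_ * _).
  rewrite exchange_big/= mulr_sumr; apply: eq_bigr => i _.
  transitivity (n`!%:R^-1 * \sum_(s : 'S_n) Y w (s i)).
    by congr (_ * _); apply: eq_bigr => s _; rewrite tnth_mktuple.
  by rewrite mean_perm sumY mulr1.
have := sum_triangle (fun _ : 'I_n => n%:R^-1 : R).
rewrite !sumr_const card_ord -[n%:R^-1 *+ n]mulr_natr -[_ ^+ 2 *+ n]mulr_natr.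
rewrite mulVf// expr1n expr2 -mulrA mulVf// mulr1.
by move=> <-; rewrite [RHS]mulrAC divff ?mul1r ?pnatr_eq0.
Qed.

(** The mean first length of the D-partition exceeds that of the T-partition by
    half the mean of the sum [V] of the squared deviations of the lengths from
    [1/n], which is positive because the lengths are distinct. *)
Lemma lengths_not_same_law : (2 <= n)%N ->
  ~ same_law P (lengths D_seq) (lengths T_seq).
Proof.
move=> n2 same; have [_ _ len_inj _] := hu.
pose h (z : seq R) := `|head 0 z|.
have mh : seq_mfun h.
  move=> m; apply: measurableT_comp => //.
  rewrite (_ : (fun _ => _) = fun t : m.-tuple R => nth 0 t 0).
    exact: measurable_nth.
  by apply/funext => -[[|p t] i].
have rlen X : seq_random X -> seq_random (lengths X : Omega -> seq R).
  move=> rX A mA; apply: (rX [set z | A [seq p.1 | p <- z]]).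
  by apply: seq_measurable_map => //; exact: measurable_fst.
have mhD : measurable_fun setT (fun w => h (lengths D_seq w)).
  exact: (measurable_seq_mfun mh (rlen _ rD)).
have mhT : measurable_fun setT (fun w => h (lengths T_seq w)).
  exact: (measurable_seq_mfun mh (rlen _ rT)).
(* Equality in law is transferred to the means of the first lengths. *)
have same_mean : (\int[P]_w (h (lengths D_seq w))%:E =
    \int[P]_w (h (lengths T_seq w))%:E)%E.
  have pushE (f : Omega -> R) (mf : measurable_fun setT f) : (forall w, 0 <= f w) ->
      (\int[P]_w (f w)%:E = \int[pushforward P f]_(x in `[0%R, +oo[) x%:E)%E.
    move=> f0; rewrite ge0_integral_pushforward//=.
    - rewrite (_ : f @^-1` _ = setT)//; apply/seteqP; split => // w _.
      by rewrite /= in_itv/= f0.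
    - by move=> x; rewrite inE /= in_itv/= andbT lee_fin.
  rewrite (pushE _ mhD); last by move=> w; exact: normr_ge0.
  rewrite (pushE _ mhT); last by move=> w; exact: normr_ge0.
  apply: eq_measure_integral => B mB _.
  apply: (same (h @^-1` B)) => m; rewrite -[X in measurable X]setTI.
  exact: (mh m).
pose V w := \sum_i (len w i - n%:R^-1) ^+ 2.
have V0 w : 0 <= V w by apply: sumr_ge0 => i _; exact: sqr_ge0.
have mV : measurable_fun setT V.
  apply: measurable_sum => i; apply: measurable_funX; apply: measurable_funB => //.
  exact: (measurableT_comp (measurable_tnth i) (measurable_ltuple u)).
have n0 : (n%:R : R) != 0 by rewrite pnatr_eq0 -lt0n.
have VE w : V w = \sum_i len w i ^+ 2 - n%:R^-1.
  rewrite /V; under eq_bigr do rewrite sqrrB -mulr_natr -mulrA.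
  rewrite big_split/= sumrB -mulr_suml sum_len sumr_const card_ord.
  by rewrite -[X in _ + X]mulr_natr; field.
have intV : (\int[P]_w (V w)%:E = 0)%E.
  have c0 : 0 <= (1 + n%:R^-1) / 2 :> R by rewrite divr_ge0// addr_ge0// invr_ge0.
  have : (\int[P]_w ((1 + n%:R^-1) / 2 + 2^-1 * V w)%:E = ((1 + n%:R^-1) / 2)%:E)%E.
    rewrite -T_mean -[RHS]same_mean [RHS]D_mean; apply: eq_integral => w _.
    by congr (_%:E); rewrite VE; field.
  under eq_integral do rewrite EFinD.
  rewrite ge0_integralD//; last 2 first.
  - by move=> w _; rewrite lee_fin mulr_ge0.
  - by apply/measurable_EFinP/measurable_funM.
  rewrite integral_cst// [X in (_ * X + _)%E]probability_setT mule1.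
  under eq_integral do rewrite EFinM.
  rewrite ge0_integralZl//; last 2 first.
  - exact/measurable_EFinP.
  - by move=> w _; rewrite lee_fin.
  have : (0 <= \int[P]_w (V w)%:E)%E by apply: integral_ge0 => w _; rewrite lee_fin.
  case: (\int[P]_w (V w)%:E)%E => [r| |] // _.
    by rewrite -EFinM -EFinD => -[E]; congr (_%:E); lra.
  by rewrite gt0_muley// lte_fin.
have ae0 : {ae P, forall w, V w = 0}.
  have mEV : measurable_fun setT (EFin \o V) by exact/measurable_EFinP.
  have /(ae_eq_integral_abs _ measurableT mEV) : (\int[P]_w `|(EFin \o V) w| = 0)%E.
    by rewrite -[RHS]intV; apply: eq_integral => w _; rewrite /= ger0_norm.
  by apply: filterS => w /(_ Logic.I) [].
have [N [mN PN0 Nall]] : {ae P, forall w, False}.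
  apply: filterS2 ae0 len_inj => w Vw inj.
  have lenE i : Defs.len u i w = n%:R^-1.
    have := Vw; rewrite /V => /eqP; rewrite psumr_eq0 => [|k _]; last exact: sqr_ge0.
    move=> /allP/(_ i (mem_index_enum _)); rewrite sqrf_eq0 subr_eq0 => /eqP.
    by rewrite tnth_mktuple.
  have := inj (Ordinal n_pos) (Ordinal n2); rewrite !lenE => /(_ erefl).
  by move/(congr1 val).
have NT : N = setT by apply/seteqP; split => // w _; apply: Nall => /=.
by move: PN0; rewrite NT probability_setT => /eqP; rewrite onee_eq0.
Qed.

End TwoPartitions.

Theorem lemma26 (R : realType) (d : measure_display)
    (Omega : measurableType d) (P : probability Omega R) (n : nat)
    (u : 'I_n.+1 -> {RV P >-> R})
    (U : nat -> {RV P >-> R}) (T : nat -> {RV P >-> R})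
    (hu : exchangeable_partition u)
    (hU : uniform_inputs u U)
    (hT : T_chain u T) :
  let D_seq := bivariate u (DV u U) in
  let T_seq := bivariate u (fun j => T j) in
  [/\ same_law P (ranked D_seq) (ranked T_seq),
      is_biased_order P (fun p : R * nat => p.1) D_seq (ranked D_seq),
      is_biased_order P (fun p : R * nat => p.2%:R) T_seq (ranked T_seq) &
      same_law P (counts D_seq) (counts T_seq) /\
      ((2 <= n)%N -> ~ same_law P (lengths D_seq) (lengths T_seq))].
Proof.
have u01 w : u ord0 w = 0 /\ u ord_max w = 1 by have [] := hu.
have u_incr w (i j : 'I_n.+1) : (i < j)%N -> u i w < u j w.
  by have [_ + _ _] := hu; apply.
split.
- exact: (ranked_same_law hu hU hT).
- exact: (D_biased_order hu hU).
- exact: (T_biased_order hu hT).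
- by split; [exact: counts_same_law|exact: lengths_not_same_law].
Qed.
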